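(* In the setting described in the context, suppose that there is a sequence $\{\mu_t\}_{t\in\mathbb{N}}$ of nonnegative (possibly random) numbers such that, for every $t\in\mathbb{N}$, $$\|y_{t+1}-y_{\mathrm{ss}}(u_t,w_t)\|\le\mu_t,\qquad y_{t+1}=h\big(f(x_t,u_t,w_t),w_t\big).$$ Fix $\varepsilon>0$ and let the probing ratios be $\delta_t=1/\sqrt{t+1}$. Let $T\ge2$ be an even integer, and suppose that $$2L_{\Psi,y}L_{y_{\mathrm{ss}},w}\sum_{t=0}^{T-1}\|w_{t+1}-w_t\|+2L_{\Psi,y}\sum_{t=0}^{T-1}\mathbb{E}[\mu_t]\le\frac{\varepsilon\sqrt{T}}{2(\sqrt2+1)\sqrt{2\pi p}} .$$ Then, if $$T\ge\max\Big\{\frac{2\pi p(\sqrt2+1)^2}{\varepsilon^2}\big(4(\Phi_0(u_0)-\Phi_{\mathrm{low}})+L\big)^2,\ \frac{8\pi p(\sqrt2+1)^2L^2}{\varepsilon^2}\log^2\Big(\frac{2(\sqrt2+1)\sqrt{2\pi p}\,L}{\varepsilon}\Big)\Big\},$$ the iterates generated by the two-point direct search for equilibrium selection satisfy $$\min_{t\in[T]_2}\mathbb{E}\big[\|\nabla\Phi_t(u_t)\|\big]\le\varepsilon .$$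
   Context: $\mathbb{N}=\{0,1,2,\dots\}$; $\|\cdot\|$ is the Euclidean norm; $\log$ is the natural logarithm; for even $T\ge2$, $[T]_2=\{0,2,\dots,T-2\}$. Plant: $x_{t+1}=f(x_t,u_t,w_t)$, $y_{t+1}=h(x_{t+1},w_t)$, with state $x_t\in\mathbb{R}^n$, input $u_t\in\mathbb{R}^p$, output $y_t\in\mathbb{R}^q$ and deterministic disturbance sequence $w_t\in\mathbb{R}^r$. There are constants $L_{f,x}\in(0,1)$ and $L_{f,u},L_{f,w},L_{h,x},L_{h,w}\ge0$ such that, for all $x,\bar x,u,\bar u,w,\bar w$: $\|f(x,u,w)-f(\bar x,u,w)\|\le L_{f,x}\|x-\bar x\|$, $\|f(x,u,w)-f(x,\bar u,w)\|\le L_{f,u}\|u-\bar u\|$, $\|f(x,u,w)-f(x,u,\bar w)\|\le L_{f,w}\|w-\bar w\|$, $\|h(x,w)-h(\bar x,w)\|\le L_{h,x}\|x-\bar x\|$, $\|h(x,w)-h(x,\bar w)\|\le L_{h,w}\|w-\bar w\|$. Steady-state maps: $x_{\mathrm{ss}}(u,w)$ is the unique solution of $f(x_{\mathrm{ss}}(u,w),u,w)=x_{\mathrm{ss}}(u,w)$, and $y_{\mathrm{ss}}(u,w)=h(x_{\mathrm{ss}}(u,w),w)$. Set $L_{y_{\mathrm{ss}},w}=L_{h,w}+\frac{L_{h,x}L_{f,w}}{1-L_{f,x}}$. Cost: $\Psi:\mathbb{R}^p\times\mathbb{R}^q\to\mathbb{R}$ is $L_{\Psi,y}$-Lipschitz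 in its second argument, uniformly in the first. The reduced cost is $\Phi_t(u)=\Psi(u,y_{\mathrm{ss}}(u,w_t))$; for every $t$ it is differentiable with $L$-Lipschitz gradient ($L>0$ independent of $t$) and bounded below by $\Phi_{\mathrm{low}}\in\mathbb{R}$ (independent of $t$). The map $u\mapsto\Psi(u,h(f(x,u,w_t),w_t))$ is continuous for every $x\in\mathbb{R}^n$ and $t\in\mathbb{N}$. Two-point direct search for equilibrium selection: given deterministic $u_0\in\mathbb{R}^p$, $x_0\in\mathbb{R}^n$ and a deterministic sequence of positive probing ratios $\delta_t$, for $t=0,2,4,\dots$: apply $u_t$, giving $x_{t+1}=f(x_t,u_t,w_t)$, $y_{t+1}=h(x_{t+1},w_t)$; draw $v_t\sim\mathcal{N}(0,\frac1pI_p)$ independently of all previous draws and set $u_{t+1}=u_t+\delta_tv_t$; apply $u_{t+1}$, giving $x_{t+2}=f(x_{t+1},u_{t+1},w_{t+1})$, $y_{t+2}=h(x_{t+2},w_{t+1})$; set $u_{t+2}=u_{t+1}$ if $\Psi(u_{t+1},y_{t+2})\le\Psi(u_t,y_{t+1})$, and $u_{t+2}=u_t$ otherwise. $\mathbb{E}$ is expectation over the random directions. *)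

(* Defs.v *)
From HB Require Import structures.
From mathcomp Require Import all_boot all_order all_algebra.
From mathcomp Require Import all_classical all_reals all_analysis.
Set Implicit Arguments.
Unset Strict Implicit.
Unset Printing Implicit Defensive.
Import Order.TTheory GRing.Theory Num.Theory.
Import numFieldNormedType.Exports.
Local Open Scope classical_set_scope.
Local Open Scope ring_scope.

(* The library norm `|x| on 'rV[R]_m is the sup norm, hence this definition.
   The two norms induce the same topology, so the library's [continuous] and
   [differentiable] on 'rV[R]_m have their usual meaning. *)
Definition enorm (R : realType) (m : nat) (x : 'rV[R]_m) : R :=
  Num.sqrt (\sum_(i < m) x 0 i ^+ 2).

Definition gradient (R : realType) (m : nat) (F : 'rV[R]_m -> R)
    (u : 'rV[R]_m) : 'rV[R]_m :=
  \row_(i < m) 'D_(delta_mx 0 i) F u.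

Definition borel_rV (R : realType) (m : nat) : set (set 'rV[R]_m) :=
  <<s @open 'rV[R]_m >>.

Definition random_vector (R : realType) (m : nat) (d : measure_display)
    (Omega : measurableType d) (X : Omega -> 'rV[R]_m) : Prop :=
  forall A, borel_rV A -> measurable (X @^-1` A).

Definition mutually_independent (R : realType) (m : nat)
    (d : measure_display) (Omega : measurableType d) (P : probability Omega R)
    (I : choiceType) (X : I -> Omega -> 'rV[R]_m) : Prop :=
  forall (J : seq I) (A : I -> set 'rV[R]_m),
    uniq J -> (forall i, borel_rV (A i)) ->
    P (\bigcap_(i in [set i | i \in J]) (X i @^-1` A i)) =
    (\prod_(i <- J) P (X i @^-1` A i))%E.

(* The real normal law of mean m and variance s2.  The null-variance case is
   the Dirac mass; the library's [normal_prob m 0] is instead the uniform law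
   on [0, 1]. *)
Definition normal_law (R : realType) (m s2 : R) (B : set R) : \bar R :=
  if s2 == 0 then \d_m B else normal_prob m (Num.sqrt s2) B.

(* X ~ N(m, S): every linear form of X is normal, with the mean and variance
   prescribed by m and the covariance matrix S. *)
Definition multivariate_normal (R : realType) (k : nat) (d : measure_display)
    (Omega : measurableType d) (P : probability Omega R)
    (X : Omega -> 'rV[R]_k) (m : 'rV[R]_k) (S : 'M[R]_k) : Prop :=
  random_vector X /\
  forall (a : 'cV[R]_k) (B : set R), measurable B ->
    P [set s | B ((X s *m a) 0 0)] =
    normal_law ((m *m a) 0 0) ((a^T *m S *m a) 0 0) B.

Record lipschitz_plant (R : realType) (n p q r : nat)
    (f : 'rV[R]_n -> 'rV[R]_p -> 'rV[R]_r -> 'rV[R]_n)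
    (h : 'rV[R]_n -> 'rV[R]_r -> 'rV[R]_q)
    (Lfx Lfu Lfw Lhx Lhw : R) : Prop := LipschitzPlant {
  Lfx_gt0 : 0 < Lfx;
  Lfx_lt1 : Lfx < 1;
  Lfu_ge0 : 0 <= Lfu;
  Lfw_ge0 : 0 <= Lfw;
  Lhx_ge0 : 0 <= Lhx;
  Lhw_ge0 : 0 <= Lhw;
  plant_fx : forall x x' u w,
    enorm (f x u w - f x' u w) <= Lfx * enorm (x - x');
  plant_fu : forall x u u' w,
    enorm (f x u w - f x u' w) <= Lfu * enorm (u - u');
  plant_fw : forall x u w w',
    enorm (f x u w - f x u w') <= Lfw * enorm (w - w');
  plant_hx : forall x x' w,
    enorm (h x w - h x' w) <= Lhx * enorm (x - x');
  plant_hw : forall x w w',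
    enorm (h x w - h x w') <= Lhw * enorm (w - w') }.

Definition steady_state_map (R : realType) (n p r : nat)
    (f : 'rV[R]_n -> 'rV[R]_p -> 'rV[R]_r -> 'rV[R]_n)
    (xss : 'rV[R]_p -> 'rV[R]_r -> 'rV[R]_n) : Prop :=
  forall u w, unique (fun x => f x u w = x) (xss u w).

Definition steady_output (R : realType) (n p q r : nat)
    (h : 'rV[R]_n -> 'rV[R]_r -> 'rV[R]_q)
    (xss : 'rV[R]_p -> 'rV[R]_r -> 'rV[R]_n)
    (u : 'rV[R]_p) (w : 'rV[R]_r) : 'rV[R]_q :=
  h (xss u w) w.

Definition reduced_cost (R : realType) (n p q r : nat)
    (h : 'rV[R]_n -> 'rV[R]_r -> 'rV[R]_q)
    (xss : 'rV[R]_p -> 'rV[R]_r -> 'rV[R]_n)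
    (Psi : 'rV[R]_p -> 'rV[R]_q -> R) (w : nat -> 'rV[R]_r)
    (t : nat) (u : 'rV[R]_p) : R :=
  Psi u (steady_output h xss u (w t)).

(* One sample path (x, u, y) of the algorithm, for a realization v of the
   directions.  Only the directions with an even index are used, and y 0 is
   unconstrained since outputs start at time 1. *)
Record direct_search_path (R : realType) (n p q r : nat)
    (f : 'rV[R]_n -> 'rV[R]_p -> 'rV[R]_r -> 'rV[R]_n)
    (h : 'rV[R]_n -> 'rV[R]_r -> 'rV[R]_q)
    (Psi : 'rV[R]_p -> 'rV[R]_q -> R) (w : nat -> 'rV[R]_r)
    (delta : nat -> R) (u0 : 'rV[R]_p) (x0 : 'rV[R]_n)
    (v : nat -> 'rV[R]_p)
    (x : nat -> 'rV[R]_n) (u : nat -> 'rV[R]_p) (y : nat -> 'rV[R]_q) : Prop :=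
  DirectSearchPath {
  path_u0 : u 0%N = u0;
  path_x0 : x 0%N = x0;
  path_state : forall t, x t.+1 = f (x t) (u t) (w t);
  path_output : forall t, y t.+1 = h (x t.+1) (w t);
  path_probe : forall t, ~~ odd t -> u t.+1 = u t + delta t *: v t;
  path_select : forall t, ~~ odd t ->
    u t.+2 = if Psi (u t.+1) (y t.+2) <= Psi (u t) (y t.+1)
             then u t.+1 else u t }.

(* Main.v *)
Require Import Defs.
From HB Require Import structures.
From mathcomp Require Import all_boot all_order all_algebra.
From mathcomp Require Import all_classical all_reals all_analysis.
From mathcomp Require Import measurable_realfun ring lra.
Set Implicit Arguments.
Unset Strict Implicit.
Unset Printing Implicit Defensive.
Import Order.TTheory GRing.Theory Num.Theory.
Import numFieldNormedType.Exports.
Local Open Scope classical_set_scope.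
Local Open Scope ring_scope.

(** Consider one round, starting at an even time t from the incumbent u_t.  The
candidate with the smaller measured cost is kept, so, up to the measurement errors
mu_t, mu_(t+1) and the drift of the reduced cost caused by w, the cost after the
round exceeds neither Phi_t(u_t) nor Phi_t(u_t + delta_t v_t).  As Phi_t is smooth,
the second value is at most
  Phi_t(u_t) + delta_t <grad, v_t> + (L / 2) delta_t^2 |v_t|^2;
using it when <grad, v_t> <= 0 and the first value otherwise, the round gains at
least delta_t max(0, - <grad, v_t>), minus the quadratic term ([search_step]).
Telescoping against the lower bound Phi_low yields a pathwise inequality between
sums of nonnegative terms ([search_path_sum]), which can be integrated without
asking whether the costs themselves are integrable.

The incumbent u_t is a function of the directions drawn before v_t, hence is
independent of v_t ([incumbent_independent]).  For a fixed gradient, <grad, v_t> is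
centred normal with variance |grad|^2 / p, and its positive part has mean
|grad| / c with c = sqrt (2 pi p); by Fubini the gain has expectation
delta_t E|grad| / c ([expected_pos_part]).  Since E|v_t|^2 <= 1, writing D for
Phi_0(u_0) - Phi_low,
  sum delta_t E|grad Phi_t(u_t)| <= c (D + (L / 2) sum delta_t^2 + errors)
([expected_gradient_sum]), where the sums run over the even times below T.  Only
one-dimensional marginals of v_t are involved.

With delta_t = 1 / sqrt (t + 1), the sum of the delta_t is at least sqrt (T / 2)
and that of their squares is at most 1 + ln (sqrt T).  If every E|grad Phi_t(u_t)|
exceeded eps, this would contradict the two lower bounds on T
([threshold_bound]). *)

(** * Euclidean norm and smooth functions *)

Definition dotv (R : realType) (m : nat) (a b : 'rV[R]_m) : R :=
  \sum_(i < m) a 0 i * b 0 i.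

Section euclidean.
Context {R : realType} {m : nat}.
Implicit Types a b c : 'rV[R]_m.

Lemma dotvDl a b c : dotv (a + b) c = dotv a c + dotv b c.
Proof.
by rewrite /dotv -big_split /=; apply: eq_bigr => i _; rewrite mxE mulrDl.
Qed.

Lemma dotvC a b : dotv a b = dotv b a.
Proof. by apply: eq_bigr => i _; rewrite mulrC. Qed.

Lemma dotvZl k a b : dotv (k *: a) b = k * dotv a b.
Proof. by rewrite mulr_sumr; apply: eq_bigr => i _; rewrite mxE mulrA. Qed.

Lemma dotvDr a b c : dotv a (b + c) = dotv a b + dotv a c.
Proof. by rewrite dotvC dotvDl !(dotvC a). Qed.

Lemma dotvZr k a b : dotv a (k *: b) = k * dotv a b.
Proof. by rewrite dotvC dotvZl dotvC. Qed.

Lemma dotvBl a b c : dotv (a - b) c = dotv a c - dotv b c.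
Proof. by rewrite -scaleN1r dotvDl dotvZl mulN1r. Qed.

Lemma dotvv_ge0 a : 0 <= dotv a a.
Proof. by apply: sumr_ge0 => i _; rewrite -expr2 sqr_ge0. Qed.

Lemma enorm_ge0 a : 0 <= enorm a.
Proof. exact: sqrtr_ge0. Qed.

Lemma enorm_sqr a : enorm a ^+ 2 = dotv a a.
Proof.
rewrite sqr_sqrtr; last by apply: sumr_ge0 => i _; rewrite sqr_ge0.
by apply: eq_bigr => i _; rewrite expr2.
Qed.

Lemma cauchy_schwarz a b : `|dotv a b| <= enorm a * enorm b.
Proof.
rewrite -ler_sqr ?nnegrE ?mulr_ge0 ?enorm_ge0// exprMn !enorm_sqr.
rewrite real_normK ?num_real//.
have [b0|b0] := eqVneq (dotv b b) 0.
  have bz : b = 0.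
    apply/rowP => i; rewrite mxE.
    move/eqP: b0; rewrite psumr_eq0; last by move=> j _; rewrite -expr2 sqr_ge0.
    by move=> /allP/(_ i (mem_index_enum _)) /=; rewrite mulf_eq0 orbb => /eqP.
  by rewrite b0 mulr0 bz dotvC -(scale0r 0) dotvZl mul0r expr0n.
have bp : 0 < dotv b b by rewrite lt_neqAle eq_sym b0 dotvv_ge0.
(* |b|^2 times the component of [a] orthogonal to [b]. *)
have := dotvv_ge0 (dotv b b *: a + (- dotv a b) *: b).
rewrite !(dotvDl, dotvDr, dotvZl, dotvZr) (dotvC b a) => H.
rewrite -(ler_pM2l bp) -subr_ge0.
by apply: le_trans H _; rewrite le_eqVlt; apply/orP; left; apply/eqP; ring.
Qed.

Lemma ler_enormD a b : enorm (a + b) <= enorm a + enorm b.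
Proof.
rewrite -ler_sqr ?nnegrE ?addr_ge0 ?enorm_ge0// enorm_sqr sqrrD !enorm_sqr.
rewrite !(dotvDl, dotvDr) (dotvC b a).
have := le_trans (ler_norm _) (cauchy_schwarz a b).
lra.
Qed.

Lemma enormN a : enorm (- a) = enorm a.
Proof. by congr Num.sqrt; apply: eq_bigr => i _; rewrite mxE sqrrN. Qed.

Lemma enormZ k a : enorm (k *: a) = `|k| * enorm a.
Proof.
rewrite -sqrtr_sqr -sqrtrM ?sqr_ge0//; congr Num.sqrt.
by rewrite mulr_sumr; apply: eq_bigr => i _; rewrite mxE exprMn.
Qed.

Lemma coord_le_enorm a i : `|a 0 i| <= enorm a.
Proof.
rewrite -sqrtr_sqr ler_sqrt; last by apply: sumr_ge0 => j _; rewrite sqr_ge0.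
by rewrite (bigD1 i)//= lerDl sumr_ge0// => j _; rewrite sqr_ge0.
Qed.

Lemma norm_le_enorm a : `|a| <= enorm a.
Proof.
rewrite /Num.norm/= mx_normrE; apply: bigmax_le => /=; first exact: enorm_ge0.
by move=> [i j] _ /=; rewrite ord1 coord_le_enorm.
Qed.

Lemma coord_le_norm a i : `|a 0 i| <= `|a|.
Proof.
rewrite [leRHS]/Num.norm/= mx_normrE.
exact: (le_bigmax (0 : R) (fun ij : 'I_1 * 'I_m => `|a ij.1 ij.2|) (0, i)).
Qed.

Lemma enorm_le_norm a : enorm a <= Num.sqrt m%:R * `|a|.
Proof.
rewrite -[`|a|]ger0_norm// -[X in _ * X]sqrtr_sqr -sqrtrM ?ler0n//.
rewrite ler_sqrt ?mulr_ge0 ?ler0n ?sqr_ge0//.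
have -> : m%:R * `|a| ^+ 2 = \sum_(i < m) `|a| ^+ 2.
  by rewrite sumr_const card_ord mulr_natl.
apply: ler_sum => i _.
by rewrite -[a 0 i ^+ 2]real_normK ?num_real// ler_sqr ?nnegrE// coord_le_norm.
Qed.

End euclidean.

(** Both norms are equivalent, so a map that is Lipschitz for the Euclidean norm
is continuous for the topology of the sup norm. *)
Lemma enorm_lipschitz_continuous (R : realType) (V : normedModType R) (k : nat)
    (F : V -> 'rV[R]_k) (K : R) :
  (forall a b, enorm (F a - F b) <= K * `|a - b|) -> continuous F.
Proof.
move=> FK a; apply/cvgrPdist_lt => e e0.
have K1 : 0 < `|K| + 1 by rewrite ltr_pwDr.
near=> b.
apply: le_lt_trans (norm_le_enorm _) _; apply: le_lt_trans (FK _ _) _.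
apply: (@le_lt_trans _ _ ((`|K| + 1) * `|a - b|)).
  by rewrite ler_wpM2r// (le_trans (ler_norm K))// lerDl.
rewrite mulrC -ltr_pdivlMr//.
near: b.
have := @cvgr_dist_lt _ _ _ _ _ _ _ (@cvg_id _ (nbhs a)).
by apply; rewrite divr_gt0.
Unshelve. all: by end_near. Qed.

Section descent.
Context {R : realType} {m : nat}.
Variables (F : 'rV[R]_m -> R) (L : R).
Hypothesis dF : forall u, differentiable F u.

Lemma derive_gradient u d : 'D_d F u = dotv (gradient F u) d.
Proof.
rewrite deriveE// /dotv; under eq_bigr do rewrite mxE deriveE//.
rewrite {1}(row_sum_delta d) linear_sum; apply: eq_bigr => i _.
by rewrite linearZ mulrC.
Qed.

Lemma is_derive_line u d (s : R) :
  is_derive s 1 (fun s => F (u + s *: d)) (dotv (gradient F (u + s *: d)) d).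
Proof.
have E : (fun h : R => h^-1 *: (F (u + (h *: (1 : R) + s) *: d) - F (u + s *: d)))
       = (fun h : R => h^-1 *: (F (h *: d + (u + s *: d)) - F (u + s *: d))).
  apply/funext => h; congr (_ *: (F _ - _)).
  by rewrite [h *: (1 : R)]mulr1 scalerDl addrCA.
apply: DeriveDef.
- rewrite /derivable /= E; exact: diff_derivable.
- by rewrite -derive_gradient /derive /= E.
Qed.

Hypothesis gradL : forall u u',
  enorm (gradient F u - gradient F u') <= L * enorm (u - u').

(** A one-dimensional mean value argument along the segment, where the
derivative of the gap to the quadratic upper model is nonpositive by
Cauchy-Schwarz. *)
Lemma descent_lemma u d :
  F (u + d) <= F u + dotv (gradient F u) d + L / 2 * enorm d ^+ 2.
Proof.
pose psi (s : R) :=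
  F (u + s *: d) - s * dotv (gradient F u) d - s ^+ 2 * (L / 2 * enorm d ^+ 2).
pose dpsi (s : R) :=
  dotv (gradient F (u + s *: d)) d - dotv (gradient F u) d - s * (L * enorm d ^+ 2).
have dpsiP (s : R) : is_derive s 1 psi (dpsi s).
  have h := is_derive_line u d s.
  rewrite /psi; apply: is_derive_eq.
  by rewrite /dpsi !scaler1 /GRing.scale /=; field.
have cpsi : {within `[0, 1], continuous psi}.
  apply: continuous_subspaceT => c.
  by apply/differentiable_continuous/derivable1_diffP; case: (dpsiP c).
have [c /itvP c01] := MVT_segment ler01 (fun s _ => dpsiP s) cpsi.
rewrite subr0 mulr1 /psi scale1r scale0r addr0 !mul1r expr1n expr0n.
rewrite !mul0r mul1r !subr0 => E.
suff : dpsi c <= 0 by rewrite -E; lra.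
rewrite /dpsi -dotvBl subr_le0.
apply: le_trans (ler_norm _) _; apply: le_trans (cauchy_schwarz _ _) _.
rewrite expr2 !mulrA ler_wpM2r ?enorm_ge0//.
apply: le_trans (gradL _ _) _.
by rewrite addrAC subrr add0r enormZ ger0_norm ?c01// mulrA (mulrC L).
Qed.

End descent.

(** * Borel random vectors *)

(** Random vectors are treated as measurable maps into this measurable space,
whose sigma-algebra is [borel_rV] by definition. *)
Local Notation borelT R m := (g_sigma_algebraType (@open 'rV[R]_m)).

Section borel.
Context {R : realType}.

Lemma measurable_borelP d (Om : measurableType d) (m : nat) (X : Om -> 'rV[R]_m) :
  (forall A, open A -> measurable (X @^-1` A)) ->
  measurable_fun setT (X : Om -> borelT R m).
Proof.
move=> oX.
apply: (@measurability _ _ Om (borelT R m) setT X (@open 'rV[R]_m) erefl).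
by move=> _ [A oA <-]; rewrite setTI; exact: oX.
Qed.

Lemma random_vectorP d (Om : measurableType d) (m : nat) (X : Om -> 'rV[R]_m) :
  random_vector X -> measurable_fun setT (X : Om -> borelT R m).
Proof. by move=> rX _ A mA; rewrite setTI; exact: rX. Qed.

Lemma open_measurable_rV m (A : set 'rV[R]_m) :
  open A -> measurable (A : set (borelT R m)).
Proof. exact: sub_sigma_algebra. Qed.

Lemma continuous_measurable_rV m k (F : 'rV[R]_m -> 'rV[R]_k) :
  continuous F -> measurable_fun setT (F : borelT R m -> borelT R k).
Proof.
move=> cF; apply: measurable_borelP => A oA.
by apply: open_measurable_rV; move/continuousP : cF; exact.
Qed.

Lemma continuous_measurable_realfun m (F : 'rV[R]_m -> R) :
  continuous F -> measurable_fun setT (F : borelT R m -> R).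
Proof.
move=> cF.
apply: (@measurability _ _ (borelT R m) R setT F _ (RGenOInfty.measurableE R)).
move=> _ [_ [a ->] <-].
rewrite setTI; apply: open_measurable_rV; move/continuousP : cF; apply.
exact: interval_open.
Qed.

Lemma measurable_coord m (i : 'I_m) :
  measurable_fun setT ((fun a : 'rV[R]_m => a 0 i) : borelT R m -> R).
Proof. by apply: continuous_measurable_realfun; exact: coord_continuous. Qed.

(** An open set is a countable union of balls with rational centre and radius
1/(k+1), and the sup-norm balls are boxes. *)
Lemma measurable_rowP d (Om : measurableType d) m (X : Om -> 'rV[R]_m) :
  (forall i, measurable_fun setT (fun s => X s 0 i)) ->
  measurable_fun setT (X : Om -> borelT R m).
Proof.
move=> mX; apply: measurable_borelP => A oA.
pose c (z : 'rV[rat]_m) : 'rV[R]_m := map_mx ratr z.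
pose box (zk : 'rV[rat]_m * nat) : set 'rV[R]_m :=
  [set a | forall i, `|a 0 i - c zk.1 0 i| < zk.2.+1%:R^-1].
have -> : X @^-1` A = \bigcup_(zk in [set zk | box zk `<=` A]) (X @^-1` box zk).
  apply/seteqP; split=> s /=; last by move=> [zk zkA Xs]; exact: zkA.
  move=> AXs; have /nbhs_ballP[e /= e0 eA] : nbhs (X s) A by exact: open_nbhs_nbhs.
  have [k ke] : exists k : nat, k.+1%:R^-1 < e / 2.
    have [k _ ke] := near_infty_natSinv_lt (PosNum (divr_gt0 e0 (ltr0Sn R 1))).
    by exists k; exact: (ke k (leqnn k)).
  have [r [r0 re rE]] : exists r : R, [/\ 0 < r, r < e / 2 & k.+1%:R^-1 = r].
    by exists k.+1%:R^-1; rewrite invr_gt0 ltr0n.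
  have /choice[z zP] (i : 'I_m) : exists z : rat, `|X s 0 i - ratr z| < r.
    have [|z zP] := @rat_in_itvoo R (X s 0 i - r) (X s 0 i + r); first lra.
    exists z; move: zP; rewrite in_itv/= => /andP[z1 z2].
    by rewrite distrC ltr_norml ltrBrDr ltrBlDr (addrC r) z2 addrC z1.
  exists (\row_i z i, k) => /=; last by move=> i; rewrite /c !mxE rE.
  move=> a /= ba; apply: eA; split=> // i j; rewrite ord1 /ball/=.
  have := ba j; rewrite /c !mxE rE => baj.
  rewrite -(subrK (ratr (z j)) (X s 0 j)) -addrA (splitr e).
  apply: le_lt_trans (ler_normD _ _) _; apply: ltrD; first exact: lt_trans (zP j) re.
  by rewrite distrC (lt_trans baj).
rewrite bigcup_mkcond; apply: countable_bigcupT_measurable; first exact: countableP.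
move=> zk; case: ifP => // _.
have -> : X @^-1` box zk =
    \bigcap_(i in [set: 'I_m]) [set s | `|X s 0 i - c zk.1 0 i| < zk.2.+1%:R^-1].
  by apply/seteqP; split=> [s /= bs i _|s /= bs i]; exact: bs.
apply: fin_bigcap_measurable => // i _.
rewrite -[X in measurable X]setTI.
have -> : [set s | `|X s 0 i - c zk.1 0 i| < zk.2.+1%:R^-1] =
    (fun s => X s 0 i) @^-1` ball (c zk.1 0 i) zk.2.+1%:R^-1.
  by apply/seteqP; split=> s; rewrite /ball/= distrC.
by apply: mX => //; exact: measurable_ball.
Qed.

Lemma measurable_row_mx d (Om : measurableType d) m k (X : Om -> 'rV[R]_m)
    (Y : Om -> 'rV[R]_k) :
  measurable_fun setT (X : Om -> borelT R m) ->
  measurable_fun setT (Y : Om -> borelT R k) ->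
  measurable_fun setT ((fun s => row_mx (X s) (Y s)) : Om -> borelT R (m + k)).
Proof.
move=> mX mY; apply: measurable_rowP => i.
rewrite -[i](@fintype.splitK m k); case: (fintype.split i) => j /=.
  under eq_fun do rewrite row_mxEl.
  exact: (measurableT_comp (measurable_coord j) mX).
under eq_fun do rewrite row_mxEr.
exact: (measurableT_comp (measurable_coord j) mY).
Qed.

End borel.

(** * Measurability of the iterates *)

(** Uniform Lipschitz continuity in one argument upgrades separate continuity to
joint continuity. *)
Lemma lipschitz_continuous_pair (R : realType) (V W : normedModType R)
    (G : V -> W -> R) (K : R) :
  (forall x x' u, `|G x u - G x' u| <= K * `|x - x'|) ->
  (forall x, continuous (G x)) -> continuous (fun z : V * W => G z.1 z.2).
Proof.
move=> GK cG [a b]; apply/cvgrPdist_lt => e e0.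
have e20 : 0 < e / 2 by rewrite divr_gt0.
have K1 : 0 < `|K| + 1 by rewrite ltr_pwDr.
have h1 : \forall z \near nbhs (a, b), `|a - z.1| < e / 2 / (`|K| + 1).
  have := @cvgr_dist_lt _ _ _ _ _ _ _ (@cvg_fst _ _ (nbhs a) (nbhs b) _).
  by apply; rewrite divr_gt0.
have h2 : \forall z \near nbhs (a, b), `|G a b - G a z.2| < e / 2.
  have h2 : \forall u \near b, `|G a b - G a u| < e / 2.
    by have /cvgrPdist_lt := cG a b; exact.
  exact: (@cvg_snd _ _ (nbhs a) (nbhs b) _) h2.
near=> z.
rewrite -(subrK (G a z.2) (G a b)) -addrA (splitr e).
apply: le_lt_trans (ler_normD _ _) _; apply: ltrD; first by near: z.
apply: le_lt_trans (GK _ _ _) _.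
apply: (@le_lt_trans _ _ ((`|K| + 1) * `|a - z.1|)).
  by rewrite ler_wpM2r// (le_trans (ler_norm K))// lerDl.
rewrite mulrC -ltr_pdivlMr//; near: z; exact: h1.
Unshelve. all: by end_near. Qed.

Section measurable_pair.
Context d (Om : measurableType d) (R : realType) (m k : nat).
Variables (X : Om -> 'rV[R]_m) (Y : Om -> 'rV[R]_k).
Hypothesis mX : measurable_fun setT (X : Om -> borelT R m).
Hypothesis mY : measurable_fun setT (Y : Om -> borelT R k).

(** Concatenating the two vectors avoids comparing the product of the two Borel
sigma-algebras with the Borel sigma-algebra of the product. *)
Lemma measurable_continuous_pair (G : 'rV[R]_m -> 'rV[R]_k -> R) :
  continuous (fun z : 'rV[R]_m * 'rV[R]_k => G z.1 z.2) ->
  measurable_fun setT (fun s => G (X s) (Y s)).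
Proof.
move=> cG.
pose H (z : 'rV[R]_(m + k)) := G (lsubmx z) (rsubmx z).
have cH : continuous H.
  move=> z; apply: (@cvg_comp _ _ _ (fun z : 'rV[R]_(m + k) => (lsubmx z, rsubmx z))
    (fun z => G z.1 z.2) (nbhs z) (nbhs (lsubmx z, rsubmx z)));
    last exact: (cG (lsubmx z, rsubmx z)).
  apply: (@cvg_pair _ _ _ (nbhs z) (nbhs (lsubmx z)) (nbhs (rsubmx z))).
    exact: continuous_lsubmx.
  exact: continuous_rsubmx.
have := measurableT_comp (continuous_measurable_realfun cH)
  (measurable_row_mx mX mY).
by apply: eq_measurable_fun => s _; rewrite /H/= row_mxKl row_mxKr.
Qed.

End measurable_pair.

Lemma measurable_probe d (Om : measurableType d) (R : realType) (m : nat)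
    (X Y : Om -> 'rV[R]_m) (c : R) :
  measurable_fun setT (X : Om -> borelT R m) ->
  measurable_fun setT (Y : Om -> borelT R m) ->
  measurable_fun setT ((fun s => X s + c *: Y s) : Om -> borelT R m).
Proof.
move=> mX mY; apply: measurable_rowP => i.
under eq_fun do rewrite !mxE.
apply: measurable_funD; first exact: (measurableT_comp (measurable_coord i) mX).
apply: measurable_funM => //.
exact: (measurableT_comp (measurable_coord i) mY).
Qed.

Section path_measurability.
Context {R : realType} {n p q r : nat}.
Variables (f : 'rV[R]_n -> 'rV[R]_p -> 'rV[R]_r -> 'rV[R]_n)
  (h : 'rV[R]_n -> 'rV[R]_r -> 'rV[R]_q) (Lfx Lfu Lfw Lhx Lhw : R).
Hypothesis plant : lipschitz_plant f h Lfx Lfu Lfw Lhx Lhw.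
Variables (w : nat -> 'rV[R]_r) (Psi : 'rV[R]_p -> 'rV[R]_q -> R) (LPsi : R).
Hypothesis LPsi_ge0 : 0 <= LPsi.
Hypothesis Psi_lip : forall u y y',
  `|Psi u y - Psi u y'| <= LPsi * enorm (y - y').
Hypothesis Psi_cont : forall (x : 'rV[R]_n) (t : nat),
  continuous (fun u : 'rV[R]_p => Psi u (h (f x u (w t)) (w t))).

Lemma state_continuous (t : nat) (i : 'I_n) :
  continuous (fun z : 'rV[R]_n * 'rV[R]_p => f z.1 z.2 (w t) 0 i).
Proof.
apply: (@lipschitz_continuous_pair _ _ _ (fun x u => f x u (w t) 0 i)
  (Lfx * Num.sqrt n%:R)) => [x x' u|x].
  have := coord_le_enorm (f x u (w t) - f x' u (w t)) i.
  rewrite !mxE => /le_trans; apply; apply: le_trans (plant_fx plant _ _ _ _) _.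
  by rewrite -mulrA ler_wpM2l ?(ltW (Lfx_gt0 plant))// enorm_le_norm.
move=> u; apply: (@continuous_comp _ _ _ (fun u => f x u (w t))
  (fun a : 'rV[R]_n => a 0 i)).
  apply: (@enorm_lipschitz_continuous _ _ _ _ (Lfu * Num.sqrt p%:R)) => a b.
  apply: le_trans (plant_fu plant _ _ _ _) _.
  by rewrite -mulrA ler_wpM2l ?(Lfu_ge0 plant)// enorm_le_norm.
exact: coord_continuous.
Qed.

Lemma observed_cost_continuous (t : nat) :
  continuous (fun z : 'rV[R]_n * 'rV[R]_p => Psi z.2 (h (f z.1 z.2 (w t)) (w t))).
Proof.
apply: (@lipschitz_continuous_pair _ _ _ (fun x u => Psi u (h (f x u (w t)) (w t)))
  (LPsi * (Lhx * (Lfx * Num.sqrt n%:R)))) => // x x' u.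
apply: le_trans (Psi_lip _ _ _) _; rewrite -!mulrA ler_wpM2l//.
apply: le_trans (plant_hx plant _ _ _) _; rewrite ler_wpM2l ?(Lhx_ge0 plant)//.
apply: le_trans (plant_fx plant _ _ _ _) _.
by rewrite ler_wpM2l ?(ltW (Lfx_gt0 plant))// enorm_le_norm.
Qed.

(** The sigma-algebra on the sample space is arbitrary, so that this applies in
particular to the one generated by the past directions. *)
Lemma path_measurable d (Om : measurableType d) (delta : nat -> R) u0 x0
    (v : nat -> Om -> 'rV[R]_p) (x : nat -> Om -> 'rV[R]_n)
    (u : nat -> Om -> 'rV[R]_p) (y : nat -> Om -> 'rV[R]_q) :
  (forall s, direct_search_path f h Psi w delta u0 x0
     (v ^~ s) (x ^~ s) (u ^~ s) (y ^~ s)) ->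
  forall k, (forall i, (i < k)%N -> measurable_fun setT (v i.*2 : Om -> borelT R p)) ->
  measurable_fun setT (x k.*2 : Om -> borelT R n) /\
  measurable_fun setT (u k.*2 : Om -> borelT R p).
Proof.
move=> pathP; elim=> [|k IH] mv.
  rewrite double0 (_ : x 0%N = cst x0); last first.
    by apply/funext => s; exact: path_x0 (pathP s).
  rewrite (_ : u 0%N = cst u0); last first.
    by apply/funext => s; exact: path_u0 (pathP s).
  by split; exact: measurable_cst.
have [|mx mu] := IH; first by move=> i ik; apply: mv; rewrite ltnS ltnW.
have ek : ~~ odd k.*2 by rewrite odd_double.
have mstate t : measurable_fun setT (x t : Om -> borelT R n) ->
    measurable_fun setT (u t : Om -> borelT R p) ->
    measurable_fun setT (x t.+1 : Om -> borelT R n).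
  move=> mxt mut; rewrite (_ : x t.+1 = fun s => f (x t s) (u t s) (w t)); last first.
    by apply/funext => s; exact: path_state (pathP s) t.
  apply: measurable_rowP => i.
  exact: (measurable_continuous_pair mxt mut (G := fun x u => f x u (w t) 0 i)
    (@state_continuous t i)).
have mcost t : measurable_fun setT (x t : Om -> borelT R n) ->
    measurable_fun setT (u t : Om -> borelT R p) ->
    measurable_fun setT (fun s => Psi (u t s) (y t.+1 s)).
  move=> mxt mut.
  rewrite (_ : (fun s => _) =
      fun s => Psi (u t s) (h (f (x t s) (u t s) (w t)) (w t))); last first.
    apply/funext => s; have ps := pathP s.
    by rewrite (path_output ps) (path_state ps).
  apply: (measurable_continuous_pair mxt mut
    (G := fun x u => Psi u (h (f x u (w t)) (w t)))).
  exact: observed_cost_continuous.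
have mx1 := mstate _ mx mu.
have mu1 : measurable_fun setT (u k.*2.+1 : Om -> borelT R p).
  rewrite (_ : u k.*2.+1 = fun s => u k.*2 s + delta k.*2 *: v k.*2 s); last first.
    by apply/funext => s; exact: path_probe (pathP s) _ ek.
  by apply: measurable_probe => //; exact: mv.
rewrite doubleS; split; first exact: mstate.
rewrite (_ : u k.*2.+2 = fun s =>
    if Psi (u k.*2.+1 s) (y k.*2.+2 s) <= Psi (u k.*2 s) (y k.*2.+1 s)
    then u k.*2.+1 s else u k.*2 s); last first.
  by apply/funext => s; exact: path_select (pathP s) _ ek.
by apply: measurable_fun_ifT => //; apply: measurable_fun_ler; exact: mcost.
Qed.

End path_measurability.

(** * Independence and Fubini *)

Section independence.
Context d (Om : measurableType d) (R : realType) (P : probability Om R).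

(** For fixed [B], the events independent of [B] form a lambda-system, so it is
enough to test independence on a generating pi-system. *)
Lemma independent_sigma_algebra (G : set (set Om)) (B : set Om) :
  setI_closed G -> (forall A, G A -> measurable A) -> measurable B ->
  (forall A, G A -> P (A `&` B) = (P A * P B)%E) ->
  forall A, <<s G >> A -> P (A `&` B) = (P A * P B)%E.
Proof.
move=> GI mG mB indG.
pose H := [set A | measurable A /\ P (A `&` B) = (P A * P B)%E].
suff GH : <<s G >> `<=` H by move=> A /GH[].
apply: lambda_system_subset => //; last by move=> A GA; split; [exact: mG|exact: indG].
have PBfin : P B \is a fin_num by exact: fin_num_measure.
apply/dynkin_lambda_system; split.
- by split=> //; rewrite setTI probability_setT mul1e.
- move=> A [mA indA]; split; first exact: measurableC.
  rewrite setIC -setDE measureD//; last by rewrite ltey_eq fin_num_measure.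
  transitivity (P B - P A * P B)%E; first by congr (_ - _)%E; rewrite setIC.
  by rewrite probability_setC// muleBl ?mul1e// fin_num_adde_defl// fin_num_measure.
- move=> F tF HF; split; first by apply: bigcupT_measurable => i; have [] := HF i.
  rewrite setI_bigcupl measure_semi_bigcup//; last 3 first.
  + by move=> i; apply: measurableI => //; have [] := HF i.
  + exact: trivIset_setIr.
  + by apply: bigcup_measurable => i _; apply: measurableI => //; have [] := HF i.
  rewrite measure_semi_bigcup//; last 2 first.
  + by move=> i; have [] := HF i.
  + by apply: bigcup_measurable => i _; have [] := HF i.
  rewrite -(fineK PBfin) muleC -nneseriesZl; last by move=> i _.
  by apply: eq_eseriesr => i _; rewrite fineK// muleC; have [] := HF i.
Qed.

(** The law of the pair [(X, Y)] is the product of the laws of [X] and [Y], as they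
agree on rectangles; Tonelli's theorem does the rest. *)
Lemma independent_fubini d1 d2 (T1 : measurableType d1) (T2 : measurableType d2)
    (X : Om -> T1) (Y : Om -> T2) (phi : T1 * T2 -> \bar R) :
  measurable_fun setT X -> measurable_fun setT Y ->
  (forall A B, measurable A -> measurable B ->
     P (X @^-1` A `&` Y @^-1` B) = (P (X @^-1` A) * P (Y @^-1` B))%E) ->
  measurable_fun setT phi -> (forall z, 0 <= phi z)%E ->
  (\int[P]_s phi (X s, Y s) = \int[P]_s \int[P]_s' phi (X s, Y s'))%E.
Proof.
move=> mX mY ind mphi phi0.
pose X' : {mfun Om >-> T1} := HB.pack X (isMeasurableFun.Build _ _ _ _ _ mX).
pose Y' : {mfun Om >-> T2} := HB.pack Y (isMeasurableFun.Build _ _ _ _ _ mY).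
have mXY : measurable_fun setT (fun s => (X s, Y s)) by exact: measurable_fun_pair.
pose XY' : {mfun Om >-> (T1 * T2)%type} :=
  HB.pack (fun s => (X s, Y s)) (isMeasurableFun.Build _ _ _ _ _ mXY).
transitivity (\int[distribution P X' \x distribution P Y']_z phi z)%E.
  rewrite -(ge0_integral_distribution XY' mphi phi0).
  apply: eq_measure_integral => A mA _.
  by apply/esym/product_measure_unique => // ? ? ? ?; exact: ind.
rewrite fubini_tonelli1//= ge0_integral_distribution//.
- apply: eq_integral => s _ /=; rewrite /fubini_F ge0_integral_distribution//.
  exact: measurableT_comp mphi (pair1_measurable _).
- exact: measurable_fun_fubini_tonelli_F.
- by move=> z; apply: integral_ge0.
Qed.

(** The sigma-algebra of [v_0, ..., v_(k-1)] is presented by a generating family that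
is stable under intersection, as the pi-lambda theorem requires. *)
Definition past_boxes (m : nat) (v : nat -> Om -> 'rV[R]_m) (k : nat) :
    set (set Om) :=
  [set \bigcap_(i in [set i | i \in iota 0 k]) (v i @^-1` A i) |
    A in [set A : nat -> set 'rV[R]_m | forall i, borel_rV (A i)]].

Lemma past_boxes_measurable m (v : nat -> Om -> 'rV[R]_m) k i : (i < k)%N ->
  measurable_fun setT
    (v i : g_sigma_algebraType (past_boxes v k) -> borelT R m).
Proof.
move=> ik _ B mB; rewrite setTI; apply: sub_sigma_algebra.
exists (fun j => if j == i then B else setT).
  by move=> j; case: ifP => // _; exact: (@measurableT _ (borelT R m)).
apply/seteqP; split=> s /=.
  by move=> /(_ i); rewrite /= mem_iota /= add0n eqxx; apply.
by move=> Bs j _ /=; case: ifP => // /eqP ->.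
Qed.

Lemma past_independent m (v : nat -> Om -> 'rV[R]_m) k (A B : set _) :
  (forall i, measurable_fun setT (v i : Om -> borelT R m)) ->
  mutually_independent P v ->
  <<s past_boxes v k >> A -> borel_rV B ->
  P (A `&` v k @^-1` B) = (P A * P (v k @^-1` B))%E.
Proof.
move=> mv indv sA mB.
have mpre i C : borel_rV C -> measurable (v i @^-1` C).
  by move=> mC; rewrite -[X in measurable X]setTI; exact: mv.
apply: (@independent_sigma_algebra (past_boxes v k)) => //.
- move=> _ _ [C mC <-] [D mD <-]; exists (fun i => C i `&` D i).
    by move=> i; exact: (@measurableI _ (borelT R m) _ _ (mC i) (mD i)).
  apply/seteqP; split=> s /=.
    by move=> h; split=> i /= /h [].
  by move=> [h1 h2] i /= ik; split; [exact: h1|exact: h2].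
- move=> _ [C mC <-]; apply: fin_bigcap_measurable; first exact: finite_seq.
  by move=> i _; exact: mpre.
- exact: mpre.
move=> _ [C mC <-].
pose E i := if i == k then B else C i.
have mE i : borel_rV (E i) by rewrite /E; case: ifP.
have Ek : E k = B by rewrite /E eqxx.
have Elt i : i \in iota 0 k -> E i = C i.
  by rewrite mem_iota add0n /E => /= ik; rewrite ltn_eqF.
have iotaS : iota 0 k.+1 = iota 0 k ++ [:: k] by rewrite -addn1 iotaD.
have := indv (iota 0 k.+1) E (iota_uniq _ _) mE.
rewrite iotaS big_cat big_seq1 Ek.
rewrite big_seq_cond (eq_bigr (fun i => P (v i @^-1` C i))); last first.
  by move=> i /andP[/Elt -> _].
rewrite -big_seq_cond -(indv (iota 0 k) C (iota_uniq _ _) mC) => <-.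
congr (P _); apply/seteqP; split=> s /=.
  move=> [h1 h2] i /=; rewrite mem_cat mem_seq1.
  by case/orP => [/[dup] ik /Elt ->|/eqP ->]; [exact: h1|rewrite Ek].
move=> h; split=> [i /= ik|].
  by have := h i; rewrite /= Elt//; apply; rewrite mem_cat ik.
by have := h k; rewrite /= Ek; apply; rewrite mem_cat mem_seq1 eqxx orbT.
Qed.

End independence.

(** * Moments of the normal law *)

Section normal_moments.
Context {R : realType}.
Local Notation leb := (@lebesgue_measure R).

(** The density [normal_pdf m s] agrees almost everywhere with the Radon-Nikodym
derivative of the normal law, for which the change of variables is available. *)
Lemma integral_normal_prob (m s : R) (psi : R -> \bar R) :
  measurable_fun setT psi -> (forall x, 0 <= psi x)%E ->
  (\int[normal_prob m s]_x psi x = \int[leb]_x (psi x * (normal_pdf m s x)%:E))%E.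
Proof.
move=> mpsi psi0.
have dom := @normal_prob_dominates R m s.
have fint := Radon_Nikodym_SigmaFinite.f_integrable dom.
have mf := measurable_int _ fint.
rewrite -(Radon_Nikodym_SigmaFinite.change_of_variables dom)//.
have mpdf : measurable_fun setT (fun x => (normal_pdf m s x)%:E).
  by apply/measurable_EFinP; exact: measurable_normal_pdf.
apply: ae_eq_integral => //; [exact: emeasurable_funM|exact: emeasurable_funM|].
apply: ae_eqe_mul2l; apply: integral_ae_eq => // A _ mA.
by rewrite -(Radon_Nikodym_SigmaFinite.f_integral dom).
Qed.

Section density.
Variable s : R.
Hypothesis s_gt0 : 0 < s.

Lemma is_derive_normal_pdf (x : R) :
  is_derive x 1 (normal_pdf 0 s) (- (x / s ^+ 2) * normal_pdf 0 s x).
Proof.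
have s0 : s != 0 by rewrite gt_eqF.
have -> : normal_pdf 0 s =
    fun x => normal_peak s * expR (- (s ^+ 2 *+ 2)^-1 * x ^+ 2).
  apply/funext => z; rewrite normal_pdfE//; congr (_ * expR _).
  by rewrite subr0 mulNr mulNr mulrC.
apply: is_derive_eq.
rewrite !scaler1 /GRing.scale /=; field.
by rewrite s0.
Qed.

Lemma continuous_normal_pdf0 : continuous (normal_pdf 0 s).
Proof. by apply: continuous_normal_pdf; rewrite gt_eqF. Qed.

Lemma normal_pdf_cvg0 : normal_pdf 0 s x @[x --> +oo] --> (0 : R).
Proof.
have s0 : s != 0 by rewrite gt_eqF.
have -> : normal_pdf 0 s =
    fun x => normal_peak s * expR (- (x ^+ 2 * (s ^+ 2 *+ 2)^-1)).
  apply/funext => z; rewrite normal_pdfE//; congr (_ * expR _).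
  by rewrite subr0 mulNr.
rewrite -(mulr0 (normal_peak s)); apply: cvgMr.
apply: (cvg_comp (fun x => x ^+ 2 * (s ^+ 2 *+ 2)^-1) (fun x => expR (- x)));
  last exact: cvgr_expR.
apply: gt0_cvgMly; last exact: cvgr_expr2.
by rewrite invr_gt0 pmulrn_lgt0// exprn_gt0.
Qed.

(** On the half-line, [x * normal_pdf 0 s x] has the antiderivative
[- s ^+ 2 * normal_pdf 0 s x]. *)
Lemma integral_pos_part_normal :
  (\int[normal_prob 0 s]_x (Num.max 0 x)%:E = (s / Num.sqrt (2 * pi))%:E)%E.
Proof.
have s0 : s != 0 by rewrite gt_eqF.
rewrite integral_normal_prob; last 2 first.
- by apply/measurable_EFinP; apply: measurable_maxr.
- by move=> x; rewrite lee_fin le_max lexx.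
transitivity (\int[leb]_(x in `[0%R, +oo[) (x * normal_pdf 0 s x)%:E)%E.
  rewrite [RHS]integral_mkcond; apply: eq_integral => x _; rewrite patchE.
  rewrite mem_setE in_itv/= andbT -EFinM.
  by case: leP => // _; rewrite mul0r.
have dF (x : R) :
    is_derive x 1 (fun x => - s ^+ 2 * normal_pdf 0 s x) (x * normal_pdf 0 s x).
  have h := is_derive_normal_pdf x; apply: is_derive_eq.
  by rewrite /GRing.scale /=; field; rewrite s0.
rewrite (@ge0_continuous_FTC2y _ _ (fun x => - s ^+ 2 * normal_pdf 0 s x) 0 0).
- rewrite -EFinB sub0r mulNr opprK normal_pdfE// /normal_fun subr0 expr0n oppr0.
  rewrite mul0r expR0 mulr1.
  rewrite /normal_peak -mulrnAr -[pi *+ 2]mulr_natl sqrtrM ?sqr_ge0//.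
  rewrite sqrtr_sqr gtr0_norm//.
  by congr EFin; rewrite invfM expr2 mulrA -(mulrA s) divff// mulr1.
- by move=> x x0; rewrite mulr_ge0// normal_pdf_ge0.
- apply: continuous_subspaceT => x; apply: cvgM; first exact: cvg_id.
  exact: continuous_normal_pdf0.
- rewrite -[X in _ --> X](mulr0 (- s ^+ 2)); apply: cvgMr; exact: normal_pdf_cvg0.
- by move=> x _; have [] := dF x.
- apply: cvgMr; apply: cvg_at_right_filter; exact: continuous_normal_pdf0.
- by move=> x _; rewrite derive1E; have [_ ->] := dF x.
Qed.

(** Integrating by parts, i.e. with [- s ^+ 2 * x * normal_pdf 0 s x] as an
antiderivative of [(x ^+ 2 - s ^+ 2) * normal_pdf 0 s x], the truncated second
moment over [-k, k] is at most [s ^+ 2] times the truncated mass. *)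
Lemma integral_sqr_normal :
  (\int[normal_prob 0 s]_x (x ^+ 2)%:E <= (s ^+ 2)%:E)%E.
Proof.
have s0 : s != 0 by rewrite gt_eqF.
have spdf : (\int[leb]_x (s ^+ 2 * normal_pdf 0 s x)%:E = (s ^+ 2)%:E)%E.
  under eq_integral do rewrite EFinM.
  rewrite ge0_integralZl_EFin//; last 3 first.
  - by move=> x _; rewrite lee_fin normal_pdf_ge0.
  - by apply/measurable_EFinP; exact: measurable_normal_pdf.
  - exact: sqr_ge0.
  by rewrite integral_normal_pdf mule1.
have mx2 : measurable_fun setT (fun x : R => (x ^+ 2 * normal_pdf 0 s x)%:E).
  apply/measurable_EFinP/measurable_funM; last exact: measurable_normal_pdf.
  exact: measurable_funX.
have mpdf : measurable_fun setT (fun x : R => (s ^+ 2 * normal_pdf 0 s x)%:E).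
  by apply/measurable_EFinP/measurable_funM => //; exact: measurable_normal_pdf.
have dF (x : R) : is_derive x 1 (fun x => - s ^+ 2 * x * normal_pdf 0 s x)
    ((x ^+ 2 - s ^+ 2) * normal_pdf 0 s x).
  have h := is_derive_normal_pdf x; apply: is_derive_eq.
  by rewrite !scaler1 /GRing.scale /=; field; rewrite s0.
have bnd (k : nat) :
    (\int[leb]_(x in `[(- k%:R)%R, k%:R%R]) (x ^+ 2 * normal_pdf 0 s x)%:E
     <= (s ^+ 2)%:E)%E.
  case: k => [|k].
    by rewrite oppr0 set_itv1 integral_set1 lee_fin sqr_ge0.
  set K : R := k.+1%:R; have K0 : 0 < K by rewrite ltr0n.
  have cpt : compact `[- K, K] by exact: segment_compact.
  have cx2 : continuous (fun x : R => (x ^+ 2 - s ^+ 2) * normal_pdf 0 s x).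
    move=> x; apply: cvgM; last exact: continuous_normal_pdf0.
    by apply: cvgB; [exact: exprn_continuous|exact: cvg_cst].
  have cs2 : continuous (fun x : R => s ^+ 2 * normal_pdf 0 s x).
    by move=> x; apply: cvgMr; exact: continuous_normal_pdf0.
  have diff_le0 : (\int[leb]_(x in `[(- K)%R, K])
      ((x ^+ 2 - s ^+ 2) * normal_pdf 0 s x)%:E <= 0)%E.
    rewrite (@continuous_FTC2 _ _ (fun x => - s ^+ 2 * x * normal_pdf 0 s x)).
    - have -> : normal_pdf 0 s (- K) = normal_pdf 0 s K.
        by rewrite !normal_pdfE// /normal_fun !subr0 sqrrN.
      rewrite -EFinB lee_fin -mulrBl mulrN opprK -mulrDr !mulNr oppr_le0.
      by rewrite mulr_ge0 ?normal_pdf_ge0// mulr_ge0 ?sqr_ge0// ltW// addr_gt0.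
    - lra.
    - exact: continuous_subspaceT.
    - have cF : continuous (fun x : R => - s ^+ 2 * x * normal_pdf 0 s x).
        move=> x; apply: differentiable_continuous; apply/derivable1_diffP.
        by have [] := dF x.
      split; first by move=> x _; have [] := dF x.
        exact/cvg_at_right_filter/cF.
      exact/cvg_at_left_filter/cF.
    - by move=> x _; rewrite derive1E; have [_ ->] := dF x.
  under eq_integral => x _ do rewrite -[x ^+ 2](subrK (s ^+ 2)) mulrDl EFinD.
  rewrite integralD//; last 2 first.
  - by apply: continuous_compact_integrable => //; exact: continuous_subspaceT.
  - by apply: continuous_compact_integrable => //; exact: continuous_subspaceT.
  rewrite -[leRHS]add0e; apply: leeD => //; rewrite -spdf.
  apply: ge0_subset_integral => //.
  by move=> x _; rewrite lee_fin mulr_ge0 ?sqr_ge0 ?normal_pdf_ge0.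
rewrite integral_normal_prob; last 2 first.
- by apply/measurable_EFinP; exact: measurable_funX.
- by move=> x; rewrite lee_fin sqr_ge0.
under eq_integral do rewrite -EFinM.
rewrite -(bigcup_itvT true false).
have h : (\int[leb]_(x in `[(- k%:R)%R, k%:R%R])
      (x ^+ 2 * normal_pdf 0 s x)%:E)%E @[k --> \oo] -->
    (\int[leb]_(x in \bigcup_k `[(- k%:R)%R, k%:R%R]%classic)
      (x ^+ 2 * normal_pdf 0 s x)%:E)%E.
  apply: ge0_nondecreasing_set_cvg_integral => //.
  - move=> i j ij; rewrite subsetEset.
    by apply: subset_itv; rewrite bnd_simp ?lerN2 ler_nat.
  - by move=> i; exact: measurable_funTS.
  - by move=> i x _; rewrite lee_fin mulr_ge0 ?sqr_ge0 ?normal_pdf_ge0.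
rewrite -(cvg_lim _ h)//; apply: lime_le; [exact: cvgP h|exact: nearW].
Qed.

End density.
End normal_moments.

Section normal_vector.
Context d (Om : measurableType d) (R : realType) (P : probability Om R).

Lemma normal_law_moments (X : Om -> R) (s2 : R) :
  measurable_fun setT X -> 0 <= s2 ->
  (forall B, measurable B -> P [set s | B (X s)] = normal_law 0 s2 B) ->
  (\int[P]_s (Num.max 0 (X s))%:E = (Num.sqrt s2 / Num.sqrt (2 * pi))%:E)%E /\
  (\int[P]_s (X s ^+ 2)%:E <= s2%:E)%E.
Proof.
move=> mX s20 lawX.
(* The carrier on which [normal_prob] is a measure is [measurableTypeR R]. *)
pose X' : {mfun Om >-> measurableTypeR R} :=
  HB.pack (X : Om -> measurableTypeR R)
    (isMeasurableFun.Build _ _ _ (measurableTypeR R) _ mX).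
have mmax : measurable_fun setT (fun x : R => (Num.max 0 x)%:E).
  by apply/measurable_EFinP; apply: measurable_maxr.
have msqr : measurable_fun setT (fun x : R => (x ^+ 2)%:E).
  by apply/measurable_EFinP; exact: measurable_funX.
rewrite -(ge0_integral_distribution X' mmax); last first.
  by move=> x; rewrite lee_fin le_max lexx.
rewrite -(ge0_integral_distribution X' msqr); last by move=> x; rewrite lee_fin sqr_ge0.
have [s0|s0] := eqVneq s2 0.
  have tr (psi : R -> \bar R) : (\int[distribution P X']_x psi x
      = \int[\d_(0%R : measurableTypeR R)]_x psi x)%E.
    refine (eq_measure_integral _ _) => A mA _.
    by rewrite [LHS](lawX A mA) /normal_law s0 eqxx.
  rewrite !tr !integral_dirac// s0 sqrtr0 mul0r diracT !mul1e maxxx expr0n/=.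
  by split.
have s_gt0 : 0 < Num.sqrt s2 by rewrite sqrtr_gt0 lt_neqAle eq_sym s0.
have tr (psi : R -> \bar R) :
    (\int[distribution P X']_x psi x = \int[normal_prob 0 (Num.sqrt s2)]_x psi x)%E.
  refine (@eq_measure_integral _ (measurableTypeR R) R setT
    (normal_prob 0 (Num.sqrt s2)) (distribution P X') psi _) => A mA _.
  by rewrite [LHS](lawX A mA) /normal_law (negbTE s0).
rewrite !tr.
split; first exact: integral_pos_part_normal.
by rewrite -[X in (_ <= X%:E)%E](sqr_sqrtr s20); exact: integral_sqr_normal.
Qed.

Context (p : nat) (V : Om -> 'rV[R]_p).
Hypothesis p_gt0 : (0 < p)%N.
Hypothesis V_normal : multivariate_normal P V 0 (p%:R^-1)%:M.

Lemma normal_form_moments (g : 'rV[R]_p) :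
  (\int[P]_s (Num.max 0 (dotv g (V s)))%:E
   = (enorm g / Num.sqrt (2 * pi * p%:R))%:E)%E /\
  (\int[P]_s (dotv g (V s) ^+ 2)%:E <= (enorm g ^+ 2 / p%:R)%:E)%E.
Proof.
have [rV law] := V_normal.
have dE a : (a *m g^T) 0 0 = dotv g a.
  by rewrite mxE; apply: eq_bigr => i _; rewrite mxE mulrC.
have vE : (g^T^T *m (p%:R^-1)%:M *m g^T) 0 0 = enorm g ^+ 2 / p%:R.
  by rewrite trmxK mul_mx_scalar -scalemxAl mxE dE enorm_sqr mulrC.
have [|||h1 h2] :=
  @normal_law_moments (fun s => dotv g (V s)) (enorm g ^+ 2 / p%:R).
- rewrite /dotv; apply: measurable_sum => i; apply: measurable_funM => //.
  exact: (measurableT_comp (measurable_coord i) (random_vectorP rV)).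
- by rewrite divr_ge0 ?sqr_ge0.
- move=> B mB; have := law g^T B mB; rewrite vE mul0mx mxE => <-.
  by congr (P _); apply/funext => s /=; rewrite dE.
split=> //; rewrite h1; congr EFin.
rewrite sqrtrM ?sqr_ge0// sqrtr_sqr ger0_norm ?enorm_ge0//.
by rewrite (sqrtrM p%:R) ?mulr_ge0 ?pi_ge0// sqrtrV// invfM mulrA mulrAC.
Qed.

Lemma normal_sqr_norm : (\int[P]_s (enorm (V s) ^+ 2)%:E <= 1)%E.
Proof.
have [rV _] := V_normal.
have mV i : measurable_fun setT (fun s => V s 0 i).
  exact: (measurableT_comp (measurable_coord i) (random_vectorP rV)).
under eq_integral => s _.
  rewrite enorm_sqr /dotv -sumEFin.
  under eq_bigr do rewrite -expr2.
  over.
rewrite ge0_integral_sum//; last 2 first.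
- by move=> i; apply/measurable_EFinP/measurable_funX.
- by move=> i x _; rewrite lee_fin sqr_ge0.
apply: (@le_trans _ _ (\sum_(i < p) (p%:R^-1)%:E)%E).
  apply: lee_sum => i _.
  have dE s : dotv (delta_mx 0 i) (V s) = V s 0 i.
    rewrite /dotv (bigD1 i)//= big1 ?addr0 ?mxE ?eqxx ?mul1r// => j ji.
    by rewrite mxE (negbTE ji) mul0r.
  under eq_integral => s _ do rewrite -dE.
  have [_] := normal_form_moments (delta_mx 0 i).
  move=> /le_trans; apply; rewrite lee_fin enorm_sqr /dotv (bigD1 i)//= big1;
    last first.
    by move=> j ji; rewrite mxE (negbTE ji) mul0r.
  by rewrite !mxE !eqxx mulr1 addr0 mul1r.
by rewrite sumEFin sumr_const card_ord -(mulr_natl p%:R^-1) divff// pnatr_eq0 -lt0n.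
Qed.

End normal_vector.

(** * The search along one sample path *)

Section search_path.
Context {R : realType} {n p q r : nat}.
Variables (f : 'rV[R]_n -> 'rV[R]_p -> 'rV[R]_r -> 'rV[R]_n)
  (h : 'rV[R]_n -> 'rV[R]_r -> 'rV[R]_q) (Lfx Lfu Lfw Lhx Lhw : R).
Hypothesis plant : lipschitz_plant f h Lfx Lfu Lfw Lhx Lhw.
Variable xss : 'rV[R]_p -> 'rV[R]_r -> 'rV[R]_n.
Hypothesis xssP : steady_state_map f xss.
Let Ly := Lhw + Lhx * Lfw / (1 - Lfx).

(** The contraction constant [Lfx] turns the sensitivity [Lfw] of one step into the
sensitivity [Lfw / (1 - Lfx)] of the fixed point. *)
Lemma steady_output_lipschitz u w1 w2 :
  enorm (steady_output h xss u w1 - steady_output h xss u w2)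
  <= Ly * enorm (w1 - w2).
Proof.
have Lf1 : 0 < 1 - Lfx by rewrite subr_gt0 (Lfx_lt1 plant).
have xL : enorm (xss u w1 - xss u w2) <= Lfw / (1 - Lfx) * enorm (w1 - w2).
  have fix1 := (xssP u w1).1; have fix2 := (xssP u w2).1.
  have H : enorm (xss u w1 - xss u w2)
      <= Lfx * enorm (xss u w1 - xss u w2) + Lfw * enorm (w1 - w2).
    rewrite -{1}fix1 -{1}fix2.
    rewrite -(subrK (f (xss u w2) u w1) (f (xss u w1) u w1)) -addrA.
    apply: le_trans (ler_enormD _ _) _; apply: lerD.
      exact: plant_fx plant _ _ _ _.
    exact: plant_fw plant _ _ _ _.
  rewrite mulrAC ler_pdivlMr//; lra.
rewrite /steady_output -(subrK (h (xss u w2) w1) (h (xss u w1) w1)) -addrA.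
apply: le_trans (ler_enormD _ _) _.
have H1 := plant_hx plant (xss u w1) (xss u w2) w1.
have H2 := plant_hw plant (xss u w2) w1 w2.
apply: le_trans (lerD H1 H2) _.
rewrite /Ly mulrDl addrC lerD2l -!mulrA ler_wpM2l ?(Lhx_ge0 plant)//.
by rewrite mulrA.
Qed.

Lemma Lyss_ge0 : 0 <= Ly.
Proof.
rewrite addr_ge0 ?(Lhw_ge0 plant)//.
rewrite divr_ge0 ?mulr_ge0 ?(Lhx_ge0 plant) ?(Lfw_ge0 plant)//.
by rewrite subr_ge0 ltW// (Lfx_lt1 plant).
Qed.

Variables (w : nat -> 'rV[R]_r) (Psi : 'rV[R]_p -> 'rV[R]_q -> R) (LPsi L : R).
Hypothesis LPsi_ge0 : 0 <= LPsi.
Hypothesis L_ge0 : 0 <= L.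
Hypothesis Psi_lip : forall u y y',
  `|Psi u y - Psi u y'| <= LPsi * enorm (y - y').
Let Phi := reduced_cost h xss Psi w.
Hypothesis Phi_diff : forall t u, differentiable (Phi t) u.
Hypothesis grad_lip : forall t u u',
  enorm (gradient (Phi t) u - gradient (Phi t) u') <= L * enorm (u - u').
Let dw t := enorm (w t.+1 - w t).

Lemma reduced_cost_drift t u : `|Phi t.+1 u - Phi t u| <= LPsi * (Ly * dw t).
Proof.
apply: le_trans (Psi_lip _ _ _) _; rewrite ler_wpM2l//.
exact: steady_output_lipschitz.
Qed.

Variables (delta : nat -> R) (u0 : 'rV[R]_p) (x0 : 'rV[R]_n) (v : nat -> 'rV[R]_p)
  (x : nat -> 'rV[R]_n) (u : nat -> 'rV[R]_p) (y : nat -> 'rV[R]_q).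
Hypothesis delta_ge0 : forall t, 0 <= delta t.
Hypothesis path : direct_search_path f h Psi w delta u0 x0 v x u y.
Variable mu : nat -> R.
Hypothesis mu_bound : forall t,
  enorm (y t.+1 - steady_output h xss (u t) (w t)) <= mu t.

Lemma measured_cost_error t : `|Psi (u t) (y t.+1) - Phi t (u t)| <= LPsi * mu t.
Proof. by apply: le_trans (Psi_lip _ _ _) _; rewrite ler_wpM2l. Qed.

(** The kept point is compared with the probe when the drawn direction is a descent
direction, and with the incumbent otherwise, which produces the positive part. *)
Lemma search_step t : ~~ odd t ->
  Phi t.+2 (u t.+2) + delta t * Num.max 0 (dotv (- gradient (Phi t) (u t)) (v t))
  <= Phi t (u t) + L / 2 * delta t ^+ 2 * enorm (v t) ^+ 2
     + LPsi * (mu t + mu t.+1) + LPsi * (Ly * (2 * dw t + dw t.+1)).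
Proof.
move=> et.
have probe : Phi t (u t.+1) <= Phi t (u t)
    + delta t * dotv (gradient (Phi t) (u t)) (v t)
    + L / 2 * delta t ^+ 2 * enorm (v t) ^+ 2.
  rewrite (path_probe path et).
  have := descent_lemma (Phi_diff t) (grad_lip t) (u t) (delta t *: v t).
  by rewrite dotvZr enormZ exprMn ger0_norm// mulrA.
have Em := measured_cost_error t; have Em1 := measured_cost_error t.+1.
have D0 := reduced_cost_drift t (u t.+1).
have D1 := reduced_cost_drift t (u t.+2).
have D2 := reduced_cost_drift t.+1 (u t.+2).
have dw0 : 0 <= LPsi * (Ly * dw t) by rewrite !mulr_ge0 ?Lyss_ge0 ?enorm_ge0.
have m0 : 0 <= LPsi * mu t by rewrite (le_trans _ Em).
have m1 : 0 <= LPsi * mu t.+1 by rewrite (le_trans _ Em1).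
(* Selection compares measured costs, each known up to its own error; the probe is
   measured at time t+1, hence one drift term. *)
have keep : Phi t (u t.+2)
     <= Phi t (u t) + LPsi * mu t + LPsi * mu t.+1 + LPsi * (Ly * dw t)
   /\ Phi t (u t.+2)
     <= Phi t (u t.+1) + LPsi * mu t + LPsi * mu t.+1 + LPsi * (Ly * dw t).
  move: Em Em1 D0; rewrite !ler_norml (path_select path et).
  move=> /andP[? ?] /andP[? ?] /andP[? ?].
  by case: ifPn => [sel|/negP/negP]; [|rewrite -ltNge => sel]; split; lra.
move: D1 D2 keep; rewrite !ler_norml => /andP[? ?] /andP[? ?] [k0 k1].
have gE : dotv (- gradient (Phi t) (u t)) (v t)
    = - dotv (gradient (Phi t) (u t)) (v t).
  by rewrite -scaleN1r dotvZl mulN1r.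
have v0 : 0 <= L / 2 * delta t ^+ 2 * enorm (v t) ^+ 2.
  by rewrite mulr_ge0 ?sqr_ge0// mulr_ge0 ?sqr_ge0// divr_ge0.
rewrite gE; have [_|_] := leP 0 (- dotv (gradient (Phi t) (u t)) (v t)).
  by rewrite mulrN; lra.
by rewrite mulr0; lra.
Qed.

(** Each increment of [w] occurs at most twice, once as the drift between the two
measurements of a round and once as the drift of the cost over time. *)
Lemma search_path_sum Phi_low K : Phi_low <= Phi K.*2 (u K.*2) ->
  \sum_(k < K) delta k.*2 *
     Num.max 0 (dotv (- gradient (Phi k.*2) (u k.*2)) (v k.*2))
  <= Phi 0%N u0 - Phi_low + \sum_(k < K) L / 2 * delta k.*2 ^+ 2 * enorm (v k.*2) ^+ 2
     + LPsi * \sum_(0 <= t < K.*2) mu t + 2 * LPsi * Ly * \sum_(0 <= t < K.*2) dw t.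
Proof.
move=> low.
suff : Phi K.*2 (u K.*2)
  + \sum_(k < K) delta k.*2 *
      Num.max 0 (dotv (- gradient (Phi k.*2) (u k.*2)) (v k.*2))
  <= Phi 0%N u0 + \sum_(k < K) L / 2 * delta k.*2 ^+ 2 * enorm (v k.*2) ^+ 2
     + LPsi * \sum_(0 <= t < K.*2) mu t
     + 2 * LPsi * Ly * \sum_(0 <= t < K.*2) dw t by lra.
elim: K {low} => [|K IH].
  by rewrite double0 !big_ord0 !big_nil (path_u0 path) !mulr0 !addr0.
rewrite doubleS !big_ord_recr/= !big_nat_recr//=.
have eK : ~~ odd K.*2 by rewrite odd_double.
have := search_step eK.
have dw0 : 0 <= LPsi * (Ly * dw K.*2.+1) by rewrite !mulr_ge0 ?Lyss_ge0 ?enorm_ge0.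
rewrite -/(dw _) -/(dw _).
lra.
Qed.

End search_path.

(** * Step sizes and thresholds *)

Section step_sizes.
Context {R : realType}.

(** The increment of [Num.sqrt K%:R] is [1 / (sqrt (K + 1) + sqrt K)], and
[(sqrt (K + 1) + sqrt K) ^ 2 >= 2 K + 1]. *)
Lemma sum_step_ge (K : nat) :
  Num.sqrt K%:R <= \sum_(k < K) 1 / Num.sqrt k.*2.+1%:R :> R.
Proof.
elim: K => [|K IH]; first by rewrite big_ord0 sqrtr0.
rewrite big_ord_recr/=; apply: le_trans (lerD IH (lexx _)).
set a := Num.sqrt K%:R; set b := Num.sqrt K.+1%:R; set c := Num.sqrt _.
have a0 : 0 <= a by exact: sqrtr_ge0.
have b0 : 0 < b by rewrite sqrtr_gt0 ltr0n.
have c0 : 0 < c by rewrite sqrtr_gt0 ltr0n.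
have a2 : a ^+ 2 = K%:R by rewrite sqr_sqrtr.
have b2 : b ^+ 2 = K%:R + 1 by rewrite sqr_sqrtr// natr1.
have c2 : c ^+ 2 = 2 * K%:R + 1 by rewrite sqr_sqrtr// -addn1 natrD -mul2n natrM.
have cab : c <= a + b.
  rewrite -ler_sqr ?nnegrE ?addr_ge0 ?(ltW b0) ?(ltW c0)// sqrrD a2 b2 c2.
  by have := mulr_ge0 a0 (ltW b0); lra.
rewrite -lerBlDl ler_pdivlMr//.
have : (b - a) * (a + b) = 1.
  by rewrite mulrDr !mulrBl; move: a2 b2; rewrite !expr2; lra.
move=> <-; rewrite ler_wpM2l// subr_ge0.
by rewrite -ler_sqr ?nnegrE ?(ltW b0)// a2 b2 lerDl.
Qed.

(** Telescoping, with [ln x >= 1 - 1 / x] at the ratio of consecutive odd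
numbers. *)
Lemma sum_step_sqr_le (K : nat) :
  \sum_(k < K.+1) (1 / Num.sqrt k.*2.+1%:R) ^+ 2 <= 1 + ln K.*2.+1%:R / 2 :> R.
Proof.
elim: K => [|K IH].
  by rewrite big_ord_recr big_ord0 /= add0r double0 sqrtr1 divr1 expr1n ln1 mul0r addr0.
rewrite big_ord_recr /=; apply: le_trans (lerD IH (lexx _)) _.
rewrite expr_div_n expr1n sqr_sqrtr//.
set x : R := K.*2.+1%:R; set y : R := (K.+1).*2.+1%:R.
have x0 : 0 < x by rewrite ltr0n.
have yx : y = x + 2 by rewrite /y /x -natrD doubleS addn2.
have y0 : 0 < y by rewrite ltr0n.
have : ln (x / y) <= x / y - 1.
  have h : 1 + (x / y - 1) = x / y by rewrite addrC subrK.
  rewrite -{1}h; apply: le_ln1Dx.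
  by rewrite ltrBrDr addNr divr_gt0.
rewrite lnM ?posrE ?invr_gt0// lnV ?posrE//.
have -> : x / y - 1 = - (2 * (1 / y)).
  by move: y0; rewrite yx => y0; field; rewrite gt_eqF.
by move: (ln x) (ln y) (1 / y) => A B C; lra.
Qed.

(** Here [z] stands for [sqrt T], [S] and [H] for the sums of the step sizes and of
their squares.  The first threshold absorbs the initial gap and also gives
[a <= 2 z] for [a = 2 s c L / eps]; the second one gives [a ln a <= z], hence
[a ln z = a ln a + a ln (z / a) <= 2 z].  In total the left-hand side is at most
[3 / 2 * eps * z / s], and what remains is [3 / 2 < (sqrt 2 + 1) / sqrt 2]. *)
Lemma threshold_bound (c s D L eps z H S : R) :
  0 < c -> s = Num.sqrt 2 + 1 -> 0 <= D -> 0 < L -> 0 < eps -> 0 < z ->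
  c ^+ 2 * s ^+ 2 / eps ^+ 2 * (4 * D + L) ^+ 2 <= z ^+ 2 ->
  4 * c ^+ 2 * s ^+ 2 * L ^+ 2 / eps ^+ 2 * ln (2 * s * c * L / eps) ^+ 2 <= z ^+ 2 ->
  H <= 1 + ln z -> z <= Num.sqrt 2 * S ->
  c * (D + L / 2 * H + eps * z / (2 * s * c)) < eps * S.
Proof.
move=> c0 sE D0 L0 e0 z0 C1 C2 HH HS.
have r0 : 0 < Num.sqrt 2 :> R by rewrite sqrtr_gt0.
have r2 : Num.sqrt 2 * Num.sqrt 2 = 2 :> R by rewrite -expr2 sqr_sqrtr.
move: sE HS r0 r2; set r := Num.sqrt 2 => sE HS r0 r2.
have s0 : 0 < s by rewrite sE addr_gt0.
pose a := 2 * s * c * L / eps.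
have a0 : 0 < a by rewrite divr_gt0// !mulr_gt0.
have aE : a * eps = 2 * s * c * L by rewrite /a divfK ?gt_eqF.
have {}C1 : s * c * (4 * D + L) <= eps * z.
  rewrite mulrC (mulrC eps) -ler_pdivrMr//.
  rewrite -ler_sqr ?nnegrE ?(ltW z0)//; last first.
    rewrite divr_ge0 ?(ltW e0)// !mulr_ge0 ?(ltW s0) ?(ltW c0)//.
    by rewrite addr_ge0 ?(ltW L0)// mulr_ge0.
  apply: le_trans C1; rewrite le_eqVlt; apply/orP; left; apply/eqP.
  by field; rewrite gt_eqF.
have alna : a * ln a <= z.
  have [|lna] := lerP (ln a) 0.
    by move=> lna; apply: le_trans (ltW z0); rewrite mulr_ge0_le0 ?(ltW a0).
  have p0 : 0 <= a * ln a by rewrite mulr_ge0 ?ltW.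
  rewrite -ler_sqr ?nnegrE ?p0 ?(ltW z0)//.
  apply: le_trans C2; rewrite le_eqVlt; apply/orP; left; apply/eqP.
  by rewrite /a; field; rewrite gt_eqF.
have az : a <= 2 * z.
  rewrite -(ler_pM2r e0) aE.
  have : 0 <= s * c * (4 * D) by rewrite !mulr_ge0 ?(ltW s0) ?(ltW c0).
  by move: C1; rewrite mulrDr; lra.
clearbody a.
have alnz : a * ln z <= 2 * z.
  have : ln (z / a) <= z / a - 1.
    have h : 1 + (z / a - 1) = z / a by rewrite addrC subrK.
    by rewrite -{1}h; apply: le_ln1Dx; rewrite ltrBrDr addNr divr_gt0.
  rewrite lnM ?posrE ?invr_gt0// lnV ?posrE// => hl.
  have : a * (ln z - ln a) <= a * (z / a - 1) by rewrite ler_pM2l.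
  have -> : a * (z / a - 1) = z - a by field; rewrite gt_eqF.
  by rewrite mulrBr; move: alna a0; move: (a * ln z) (a * ln a) => A B; lra.
have LH : a * H <= a + 2 * z.
  apply: (@le_trans _ _ (a * (1 + ln z))); first by rewrite ler_pM2l.
  by rewrite mulrDr mulr1; lra.
have HSe : eps * z <= eps * (r * S) by rewrite ler_pM2l.
have ez : 0 < eps * z by rewrite mulr_gt0.
rewrite -(ltr_pM2l s0).
have -> : s * (c * (D + L / 2 * H + eps * z / (2 * s * c)))
    = s * c * (4 * D + L) / 4 - a * eps / 8 + (a * H) * eps / 4 + eps * z / 2.
  have LE : L = a * eps / (2 * s * c) by rewrite aE; field; rewrite !gt_eqF.
  rewrite LE; field; rewrite !gt_eqF//.
have h1 : (a * H) * eps <= (a + 2 * z) * eps by rewrite ler_pM2r.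
have h2 : a * eps <= 2 * z * eps by rewrite ler_pM2r.
have r1 : 1 < r by rewrite -sqrtr1 ltr_sqrt ?ltr1n.
have h3 : s * (eps * S) = eps * S + eps * (r * S) by rewrite sE; ring.
have h4 : r * (eps * z) <= 2 * (eps * S).
  apply: le_trans (_ : r * (eps * (r * S)) <= _); first by rewrite ler_pM2l.
  by rewrite le_eqVlt; apply/orP; left; apply/eqP; rewrite -r2; ring.
have h5 : eps * z < r * (eps * z) by rewrite ltr_pMl.
rewrite h3; lra.
Qed.

End step_sizes.

(** * Expected gradients along the search *)

Lemma measurable_enorm (R : realType) m :
  measurable_fun setT (@enorm R m : borelT R m -> R).
Proof.
have msum : measurable_fun setT
    ((fun a : 'rV[R]_m => \sum_(i < m) a 0 i ^+ 2) : borelT R m -> R).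
  by apply: measurable_sum => i; apply: measurable_funX; exact: measurable_coord.
exact: (measurableT_comp (continuous_measurable_fun (@sqrt_continuous R)) msum).
Qed.

Lemma gradient_continuous (R : realType) m (F : 'rV[R]_m -> R) (L : R) : 0 <= L ->
  (forall u u', enorm (gradient F u - gradient F u') <= L * enorm (u - u')) ->
  continuous (gradient F).
Proof.
move=> L0 gL.
apply: (@enorm_lipschitz_continuous _ _ _ _ (L * Num.sqrt m%:R)) => a b.
by apply: le_trans (gL _ _) _; rewrite -mulrA ler_wpM2l// enorm_le_norm.
Qed.

(** Conditionally on [U], the linear form [g(U) . V] is centred normal with standard
deviation [|g(U)| / sqrt p]. *)
Lemma expected_pos_part d (Om : measurableType d) (R : realType)
    (P : probability Om R) (p : nat) (U V : Om -> 'rV[R]_p) (g : 'rV[R]_p -> 'rV[R]_p) :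
  multivariate_normal P V 0 (p%:R^-1)%:M ->
  measurable_fun setT (U : Om -> borelT R p) ->
  (forall A B, borel_rV A -> borel_rV B ->
     P (U @^-1` A `&` V @^-1` B) = (P (U @^-1` A) * P (V @^-1` B))%E) ->
  continuous g ->
  (\int[P]_s (Num.max 0 (dotv (g (U s)) (V s)))%:E
   = \int[P]_s (enorm (g (U s)) / Num.sqrt (2 * pi * p%:R))%:E)%E.
Proof.
move=> Vn mU ind cg.
pose phi (z : borelT R p * borelT R p) := (Num.max 0 (dotv (g z.1) z.2))%:E.
have mg := continuous_measurable_rV cg.
have mphi : measurable_fun setT phi.
  apply/measurable_EFinP; apply: measurable_maxr => //.
  apply: measurable_sum => i; apply: measurable_funM.
    apply: (measurableT_comp (measurable_coord i)).
    exact: (measurableT_comp mg measurable_fst).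
  exact: (measurableT_comp (measurable_coord i) measurable_snd).
have phi0 z : (0 <= phi z)%E by rewrite lee_fin le_max lexx.
have := @independent_fubini _ _ _ P _ _ (borelT R p) (borelT R p) U V phi mU
  (random_vectorP Vn.1) ind mphi phi0.
move=> ->; apply: eq_integral => s _.
by have [<- _] := normal_form_moments Vn (g (U s)).
Qed.

Lemma ge0_integral_lincomb d (Om : measurableType d) (R : realType)
    (P : {measure set Om -> \bar R}) (a : nat -> R) (F : nat -> Om -> R) (K : nat) :
  (forall k, 0 <= a k) -> (forall k s, 0 <= F k s) ->
  (forall k, measurable_fun setT (F k)) ->
  (\int[P]_s (\sum_(k < K) a k * F k s)%:E
   = \sum_(k < K) (a k)%:E * \int[P]_s (F k s)%:E)%E.
Proof.
move=> a0 F0 mF; under eq_integral do rewrite -sumEFin.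
rewrite ge0_integral_sum//; last 2 first.
- by move=> k; apply/measurable_EFinP; exact: measurable_funM.
- by move=> k s _; rewrite lee_fin mulr_ge0.
apply: eq_bigr => k _; under eq_integral do rewrite EFinM.
rewrite ge0_integralZl_EFin//; first by move=> s _; rewrite lee_fin.
exact/measurable_EFinP.
Qed.

Section expected_search.
Context {R : realType} {n p q r : nat}.
Hypothesis p_gt0 : (0 < p)%N.
Variables (f : 'rV[R]_n -> 'rV[R]_p -> 'rV[R]_r -> 'rV[R]_n)
  (h : 'rV[R]_n -> 'rV[R]_r -> 'rV[R]_q) (Lfx Lfu Lfw Lhx Lhw : R).
Hypothesis plant : lipschitz_plant f h Lfx Lfu Lfw Lhx Lhw.
Variable xss : 'rV[R]_p -> 'rV[R]_r -> 'rV[R]_n.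
Hypothesis xssP : steady_state_map f xss.
Variables (w : nat -> 'rV[R]_r) (Psi : 'rV[R]_p -> 'rV[R]_q -> R)
  (LPsi L Phi_low : R).
Hypothesis LPsi_ge0 : 0 <= LPsi.
Hypothesis Psi_lip : forall u y y',
  `|Psi u y - Psi u y'| <= LPsi * enorm (y - y').
Hypothesis Psi_cont : forall (x : 'rV[R]_n) (t : nat),
  continuous (fun u : 'rV[R]_p => Psi u (h (f x u (w t)) (w t))).
Let Phi := reduced_cost h xss Psi w.
Hypothesis Phi_diff : forall t u, differentiable (Phi t) u.
Hypothesis L_ge0 : 0 <= L.
Hypothesis grad_lip : forall t u u',
  enorm (gradient (Phi t) u - gradient (Phi t) u') <= L * enorm (u - u').
Hypothesis Phi_ge : forall t u, Phi_low <= Phi t u.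
Context d (Omega : measurableType d) (P : probability Omega R).
Variable v : nat -> Omega -> 'rV[R]_p.
Hypothesis v_normal : forall t, ~~ odd t ->
  multivariate_normal P (v t) 0 (p%:R^-1)%:M.
Hypothesis v_indep : mutually_independent P (fun k : nat => v k.*2).
Variables (delta : nat -> R) (u0 : 'rV[R]_p) (x0 : 'rV[R]_n).
Hypothesis delta_ge0 : forall t, 0 <= delta t.
Variables (x : nat -> Omega -> 'rV[R]_n) (u : nat -> Omega -> 'rV[R]_p)
  (y : nat -> Omega -> 'rV[R]_q).
Hypothesis pathP : forall s : Omega, direct_search_path f h Psi w delta u0 x0
  (v ^~ s) (x ^~ s) (u ^~ s) (y ^~ s).
Variable mu : nat -> {RV P >-> R}.
Hypothesis mu_ge0 : forall t s, 0 <= mu t s.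
Hypothesis mu_bound : forall t, {ae P, forall s,
  enorm (y t.+1 s - steady_output h xss (u t s) (w t)) <= mu t s}.

Let Ly := Lhw + Lhx * Lfw / (1 - Lfx).
Let c : R := Num.sqrt (2 * pi * p%:R).
Let dw t := enorm (w t.+1 - w t).
Let F k s := enorm (gradient (Phi k.*2) (u k.*2 s)).
Let N k s := Num.max 0 (dotv (- gradient (Phi k.*2) (u k.*2 s)) (v k.*2 s)).

Let mv k : measurable_fun setT (v k.*2 : Omega -> borelT R p).
Proof.
have [|rv _] := v_normal (t := k.*2); first by rewrite odd_double.
exact: random_vectorP.
Qed.

Let mu_ k : measurable_fun setT (u k.*2 : Omega -> borelT R p).
Proof.
by have [] := path_measurable plant LPsi_ge0 Psi_lip Psi_cont pathP
  (fun i _ => mv i) (k := k).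
Qed.

Let cgrad t : continuous (gradient (Phi t)) :=
  gradient_continuous L_ge0 (grad_lip t).

(** The incumbent is a function of the earlier directions only: it is measurable
for the sigma-algebra that they generate. *)
Lemma incumbent_independent k A B : borel_rV A -> borel_rV B ->
  P (u k.*2 @^-1` A `&` v k.*2 @^-1` B)
  = (P (u k.*2 @^-1` A) * P (v k.*2 @^-1` B))%E.
Proof.
move=> mA mB; apply: (past_independent mv v_indep) => //.
have [_ mup] := @path_measurable _ _ _ _ _ _ _ _ _ _ _ _ plant _ _ _ LPsi_ge0
  Psi_lip Psi_cont _ (g_sigma_algebraType (past_boxes (fun k => v k.*2) k))
  _ _ _ _ _ _ _ pathP k
  (fun i ik => @past_boxes_measurable _ _ _ _ (fun k => v k.*2) k i ik).
by rewrite -[X in <<s _ >> X]setTI; exact: mup.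
Qed.

Let mgrad k : measurable_fun setT
  ((fun s => gradient (Phi k.*2) (u k.*2 s)) : Omega -> borelT R p).
Proof.
exact: (measurableT_comp (continuous_measurable_rV (@cgrad k.*2)) (mu_ k)).
Qed.

Let mF k : measurable_fun setT (F k).
Proof. exact: (measurableT_comp (@measurable_enorm R p) (mgrad k)). Qed.

Let mN k : measurable_fun setT (N k).
Proof.
apply: measurable_maxr => //; apply: measurable_sum => i; apply: measurable_funM.
  under eq_fun do rewrite mxE.
  apply: measurableT_comp => //.
  exact: (measurableT_comp (measurable_coord i) (mgrad k)).
exact: (measurableT_comp (measurable_coord i) (mv k)).
Qed.

Lemma expected_descent_part k :
  (\int[P]_s (N k s)%:E = (c^-1)%:E * 'E_P[F k])%E.
Proof.
have cg : continuous (fun a => - gradient (Phi k.*2) a).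
  by move=> a; exact: (cvgN (@cgrad k.*2 a)).
have ek : ~~ odd k.*2 by rewrite odd_double.
rewrite (expected_pos_part (v_normal ek) (mu_ k) (@incumbent_independent k) cg).
rewrite unlock -ge0_integralZl_EFin//.
- by apply: eq_integral => s _; rewrite enormN -EFinM mulrC.
- by move=> s _; rewrite lee_fin enorm_ge0.
- exact/measurable_EFinP.
- by rewrite invr_ge0 sqrtr_ge0.
Qed.

(** Integrating the pathwise inequality of [search_path_sum] term by term; every
term is nonnegative, so that no integrability is at stake. *)
Lemma expected_gradient_sum K :
  (\sum_(k < K) (delta k.*2 / c)%:E * 'E_P[F k]
   <= (Phi 0%N u0 - Phi_low + L / 2 * \sum_(k < K) delta k.*2 ^+ 2
       + 2 * LPsi * Ly * \sum_(0 <= t < K.*2) dw t)%:E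
      + LPsi%:E * \sum_(0 <= t < K.*2) 'E_P[mu t])%E.
Proof.
pose D := Phi 0%N u0 - Phi_low.
pose C := 2 * LPsi * Ly * \sum_(0 <= t < K.*2) dw t.
have DC0 : 0 <= D + C.
  rewrite addr_ge0 ?subr_ge0 ?Phi_ge// !mulr_ge0 ?(Lyss_ge0 plant)//.
  by rewrite sumr_ge0// => t _; exact: enorm_ge0.
pose coef k := L / 2 * delta k.*2 ^+ 2.
have coef0 k : 0 <= coef k by rewrite mulr_ge0 ?sqr_ge0// divr_ge0.
pose lhs s := \sum_(k < K) delta k.*2 * N k s.
pose V s := \sum_(k < K) coef k * enorm (v k.*2 s) ^+ 2.
pose m s := \sum_(0 <= t < K.*2) mu t s.
have N0 k s : 0 <= N k s by rewrite le_max lexx.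
have mV2 k : measurable_fun setT (fun s => enorm (v k.*2 s) ^+ 2).
  apply: measurable_funX.
  exact: (measurableT_comp (@measurable_enorm R p) (mv k)).
have mV : measurable_fun setT (EFin \o V).
  by apply/measurable_EFinP; apply: measurable_sum => k; exact: measurable_funM.
have mm : measurable_fun setT (EFin \o m).
  by apply/measurable_EFinP; apply: measurable_sum => t; exact: measurable_funP.
have V0 s : 0 <= V s by apply: sumr_ge0 => k _; rewrite mulr_ge0 ?sqr_ge0.
have m0 s : 0 <= m s by apply: sumr_ge0.
have Lm0 s : (0 <= LPsi%:E * (m s)%:E)%E by rewrite mule_ge0// lee_fin.
have pathwise : {ae P, forall s, [set: Omega] s ->
    ((lhs s)%:E <= (D + C)%:E + ((V s)%:E + LPsi%:E * (m s)%:E))%E}.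
  apply: filterS (ae_foralln mu_bound) => s mus _.
  have := search_path_sum plant xssP LPsi_ge0 L_ge0 Psi_lip Phi_diff grad_lip
    delta_ge0 (pathP s) mus (Phi_ge K.*2 (u K.*2 s)).
  rewrite -EFinM -!EFinD lee_fin => le; apply: le_trans le _.
  rewrite le_eqVlt; apply/orP; left; apply/eqP.
  by rewrite /V /m /C /D /coef /dw /Ly /Phi; ring.
have -> : (\sum_(k < K) (delta k.*2 / c)%:E * 'E_P[F k] = \int[P]_s (lhs s)%:E)%E.
  rewrite (ge0_integral_lincomb P K (fun k => delta_ge0 k.*2) N0 mN).
  by apply: eq_bigr => k _; rewrite expected_descent_part EFinM muleA.
apply: (le_trans (ae_ge0_le_integral _ _ _ _ _ pathwise)) => //.
- by move=> s _; rewrite lee_fin sumr_ge0// => k _; rewrite mulr_ge0.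
- by apply/measurable_EFinP; apply: measurable_sum => k; exact: measurable_funM.
- by move=> s _; rewrite !adde_ge0// lee_fin.
- apply: emeasurable_funD => //; apply: emeasurable_funD => //.
  exact: measurable_funeM.
rewrite ge0_integralD//; last 2 first.
- by move=> s _; rewrite adde_ge0// lee_fin.
- by apply: emeasurable_funD => //; exact: measurable_funeM.
have -> : (\int[P]_s (D + C)%:E = (D + C)%:E)%E.
  by rewrite -[RHS](expectation_cst P) unlock.
rewrite ge0_integralD//; last 2 first.
- by move=> s _; rewrite lee_fin.
- exact: measurable_funeM.
rewrite ge0_integralZl_EFin//; last by move=> s _; rewrite lee_fin.
have -> : (\int[P]_s (m s)%:E = \sum_(0 <= t < K.*2) 'E_P[mu t])%E.
  under eq_integral do rewrite /m -sumEFin.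
  rewrite ge0_integral_sum//.
  - by apply: eq_bigr => t _; rewrite unlock.
  - by move=> t; apply/measurable_EFinP; exact: measurable_funP.
  - by move=> t s _; rewrite lee_fin.
have EV : (\int[P]_s (V s)%:E <= (L / 2 * \sum_(k < K) delta k.*2 ^+ 2)%:E)%E.
  rewrite (ge0_integral_lincomb P K coef0 _ mV2); last by move=> k s; exact: sqr_ge0.
  rewrite mulr_sumr -sumEFin; apply: lee_sum => k _.
  rewrite -[leRHS]mule1; apply: lee_wpmul2l; first by rewrite lee_fin.
  have ek : ~~ odd k.*2 by rewrite odd_double.
  exact: normal_sqr_norm p_gt0 (v_normal ek).
rewrite -/D -/C (addrAC D _ C) (EFinD (D + C)).
by rewrite addeA; apply: leeD => //; exact: leeD.
Qed.

End expected_search.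

Theorem corollary4p11 (R : realType) (n p q r : nat) (p_gt0 : (0 < p)%N)
  (f : 'rV[R]_n -> 'rV[R]_p -> 'rV[R]_r -> 'rV[R]_n)
  (h : 'rV[R]_n -> 'rV[R]_r -> 'rV[R]_q)
  (Lfx Lfu Lfw Lhx Lhw : R)
  (plant : lipschitz_plant f h Lfx Lfu Lfw Lhx Lhw)
  (xss : 'rV[R]_p -> 'rV[R]_r -> 'rV[R]_n)
  (xssP : steady_state_map f xss)
  (w : nat -> 'rV[R]_r)
  (Psi : 'rV[R]_p -> 'rV[R]_q -> R) (LPsi L Phi_low : R)
  (LPsi_ge0 : 0 <= LPsi)
  (Psi_lip : forall u y y',
     `|Psi u y - Psi u y'| <= LPsi * enorm (y - y'))
  (Psi_cont : forall (x : 'rV[R]_n) (t : nat),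
     continuous (fun u : 'rV[R]_p => Psi u (h (f x u (w t)) (w t))))
  (Phi_diff : forall (t : nat) (u : 'rV[R]_p),
     differentiable (reduced_cost h xss Psi w t) u)
  (L_gt0 : 0 < L)
  (grad_lip : forall (t : nat) (u u' : 'rV[R]_p),
     enorm (gradient (reduced_cost h xss Psi w t) u
            - gradient (reduced_cost h xss Psi w t) u') <= L * enorm (u - u'))
  (Phi_ge : forall (t : nat) (u : 'rV[R]_p),
     Phi_low <= reduced_cost h xss Psi w t u)
  (d : measure_display) (Omega : measurableType d) (P : probability Omega R)
  (v : nat -> Omega -> 'rV[R]_p)
  (v_normal : forall t, ~~ odd t ->
     multivariate_normal P (v t) 0 (p%:R^-1)%:M)
  (v_indep : mutually_independent P (fun k : nat => v k.*2))
  (delta : nat -> R)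
  (deltaE : forall t, delta t = 1 / Num.sqrt (t.+1)%:R)
  (u0 : 'rV[R]_p) (x0 : 'rV[R]_n)
  (x : nat -> Omega -> 'rV[R]_n) (u : nat -> Omega -> 'rV[R]_p)
  (y : nat -> Omega -> 'rV[R]_q)
  (pathP : forall s : Omega, direct_search_path f h Psi w delta u0 x0
     (v ^~ s) (x ^~ s) (u ^~ s) (y ^~ s))
  (mu : nat -> {RV P >-> R})
  (mu_ge0 : forall t s, 0 <= mu t s)
  (mu_bound : forall t, {ae P, forall s,
     enorm (y t.+1 s - steady_output h xss (u t s) (w t)) <= mu t s})
  (eps : R) (eps_gt0 : 0 < eps) (T : nat) (T_ge2 : (2 <= T)%N)
  (T_even : ~~ odd T) :
  let Lyssw := Lhw + Lhx * Lfw / (1 - Lfx) in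
  let Phi := reduced_cost h xss Psi w in
  ((2 * LPsi * Lyssw * \sum_(0 <= t < T) enorm (w t.+1 - w t))%:E
    + (2 * LPsi)%:E * \sum_(0 <= t < T) 'E_P[mu t]
   <= (eps * Num.sqrt T%:R
       / (2 * (Num.sqrt 2 + 1) * Num.sqrt (2 * pi * p%:R)))%:E)%E ->
  Num.max
    (2 * pi * p%:R * (Num.sqrt 2 + 1) ^+ 2 / eps ^+ 2
     * (4 * (Phi 0%N u0 - Phi_low) + L) ^+ 2)
    (8 * pi * p%:R * (Num.sqrt 2 + 1) ^+ 2 * L ^+ 2 / eps ^+ 2
     * ln (2 * (Num.sqrt 2 + 1) * Num.sqrt (2 * pi * p%:R) * L / eps) ^+ 2)
  <= T%:R ->
  (\big[mine/+oo]_(0 <= t < T | ~~ odd t)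
     'E_P[fun s => enorm (gradient (Phi t) (u t s))] <= eps%:E)%E.
Proof.
move=> Lyssw Phi Herr Hthr.
pose K := T./2; have TK : T = K.*2 by rewrite even_halfK.
have K0 : (0 < K)%N by rewrite half_gt0.
pose c : R := Num.sqrt (2 * pi * p%:R).
have c0 : 0 < c by rewrite sqrtr_gt0 !mulr_gt0 ?pi_gt0 ?ltr0n.
pose s2 : R := Num.sqrt 2 + 1.
pose z : R := Num.sqrt T%:R.
have z0 : 0 < z by rewrite sqrtr_gt0 ltr0n (ltnW T_ge2).
pose D := Phi 0%N u0 - Phi_low.
have D0 : 0 <= D by rewrite subr_ge0; exact: Phi_ge.
pose M := eps * z / (2 * s2 * c).
have delta_ge0 t : 0 <= delta t by rewrite deltaE divr_ge0.
pose F k s := enorm (gradient (Phi k.*2) (u k.*2 s)).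
pose S := \sum_(k < K) delta k.*2.
pose H := \sum_(k < K) delta k.*2 ^+ 2.
have bound : (\sum_(k < K) (delta k.*2 / c)%:E * 'E_P[F k]
    <= (D + L / 2 * H + M)%:E)%E.
  apply: (le_trans (expected_gradient_sum p_gt0 plant xssP LPsi_ge0 Psi_lip Psi_cont
    Phi_diff (ltW L_gt0) grad_lip Phi_ge v_normal v_indep delta_ge0 pathP mu_ge0
    mu_bound K)).
  rewrite -TK EFinD -addeA [leRHS]EFinD leeD2lE//; apply: le_trans Herr.
  (* The expected errors are weighted by [LPsi], half the weight in [Herr]. *)
  apply: leeD => //; apply: lee_wpmul2r.
    by apply: sume_ge0 => t _; exact: expectation_ge0.
  by rewrite lee_fin ler_peMl// ler1n.
rewrite leNgt; apply/negP => lt_min.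
have Ege k : (k < K)%N -> (eps%:E <= 'E_P[F k])%E.
  move=> kK; rewrite leNgt; apply/negP => lt_eps.
  move: lt_min; rewrite ltNge => /negP; apply.
  apply: (@bigmin_inf_seq _ _ _ _ _ k.*2); rewrite ?odd_double//; last exact: ltW.
  by rewrite mem_index_iota /= TK ltn_double.
have SB : eps * S / c <= D + L / 2 * H + M.
  rewrite -lee_fin; apply: le_trans bound.
  rewrite /S -mulrA mulrC mulr_suml mulr_suml -sumEFin; apply: lee_sum => k _.
  rewrite EFinM; apply: lee_wpmul2l; last exact: Ege.
  by rewrite lee_fin divr_ge0// ltW.
have z2 : z ^+ 2 = T%:R by rewrite sqr_sqrtr.
have c2 : c ^+ 2 = 2 * pi * p%:R by rewrite sqr_sqrtr// !mulr_ge0 ?pi_ge0.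
have [thr1 thr2] : 2 * pi * p%:R * s2 ^+ 2 / eps ^+ 2 * (4 * D + L) ^+ 2 <= T%:R
    /\ 8 * pi * p%:R * s2 ^+ 2 * L ^+ 2 / eps ^+ 2
       * ln (2 * s2 * c * L / eps) ^+ 2 <= T%:R.
  by apply/andP; rewrite -ge_max.
have HK : H <= 1 + ln z.
  have -> : ln z = ln (T%:R : R) / 2.
    by rewrite -z2 lnXn// -[_ *+ 2]mulr_natr mulfK.
  have [k Kk] : exists k, K = k.+1 by exists K.-1; rewrite prednK.
  rewrite /H TK Kk; under eq_bigr do rewrite deltaE.
  apply: le_trans (sum_step_sqr_le k) _; rewrite lerD2l ler_pM2r ?invr_gt0//.
  by rewrite ler_ln ?posrE ?ltr0n// ler_nat doubleS.
have SK : z <= Num.sqrt 2 * S.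
  rewrite /z TK -mul2n natrM sqrtrM// ler_pM2l ?sqrtr_gt0//.
  by rewrite /S; under eq_bigr do rewrite deltaE; exact: sum_step_ge.
have := threshold_bound c0 erefl D0 L_gt0 eps_gt0 z0 _ _ HK SK.
rewrite -/s2 -/M z2 c2 => /(_ thr1) lt_bound.
move: SB; rewrite leNgt => /negP; apply.
rewrite ltr_pdivlMr// mulrC; apply: lt_bound.
by apply: le_trans thr2; rewrite le_eqVlt; apply/orP; left; apply/eqP; ring.
Qed.
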